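(* Let $\alpha,\theta$ be nonconstant inner functions such that $\alpha\leqslant\theta$, and let $\varphi\in L^2$ be such that all the asymmetric truncated Toeplitz operators appearing below are bounded. Consider the conjugations $C_\theta$ and $C_{\alpha,\frac{\theta}{\alpha}}$ on $K_\theta=K_\alpha\oplus\alpha K_{\frac{\theta}{\alpha}}$. Then the following equalities of antilinear operators on $K_\theta$ hold: (1) $(A^{\theta,\alpha}_\varphi\diamond\alpha A^{\theta,\frac{\theta}{\alpha}}_{\varphi\overline{\alpha}})\,C_\theta=C_\theta\,(A^{\alpha,\theta}_{\overline{\varphi}}\boxplus A^{\frac{\theta}{\alpha},\theta}_{\overline{\varphi}\alpha}\overline{\alpha})$; (2) $(A^{\theta,\alpha}_\varphi\diamond\alpha A^{\theta,\frac{\theta}{\alpha}}_{\varphi\frac{\theta}{\alpha}})\,C_{\alpha,\frac{\theta}{\alpha}}=C_{\alpha,\frac{\theta}{\alpha}}\,(A^{\alpha,\theta}_{\overline{\varphi}}\boxplus A^{\frac{\theta}{\alpha},\theta}_{\overline{\varphi\frac{\theta}{\alpha}}}\overline{\alpha})$; (3) $(A^{\theta,\alpha}_\varphi\oplus\alpha A^{\theta,\frac{\theta}{\alpha}}_\varphi)(C_{\alpha,\frac{\theta}{\alpha}}\diamond C_\theta)=(C_{\alpha,\frac{\theta}{\alpha}}\boxplus C_\theta)(A^{\alpha,\theta}_{\overline{\varphi}}\oplus A^{\frac{\theta}{\alpha},\theta}_{\overline{\varphi}}\overline{\alpha})$. Equivalently, the operators on the left-hand sides are antilinearly selfadjoint,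 i.e., (1a) $\big((A^{\theta,\alpha}_\varphi\diamond\alpha A^{\theta,\frac{\theta}{\alpha}}_{\varphi\overline{\alpha}})C_\theta\big)^\sharp=(A^{\theta,\alpha}_\varphi\diamond\alpha A^{\theta,\frac{\theta}{\alpha}}_{\varphi\overline{\alpha}})C_\theta$; (2a) $\big((A^{\theta,\alpha}_\varphi\diamond\alpha A^{\theta,\frac{\theta}{\alpha}}_{\varphi\frac{\theta}{\alpha}})C_{\alpha,\frac{\theta}{\alpha}}\big)^\sharp=(A^{\theta,\alpha}_\varphi\diamond\alpha A^{\theta,\frac{\theta}{\alpha}}_{\varphi\frac{\theta}{\alpha}})C_{\alpha,\frac{\theta}{\alpha}}$; (3a) $\big((A^{\theta,\alpha}_\varphi\oplus\alpha A^{\theta,\frac{\theta}{\alpha}}_\varphi)(C_{\alpha,\frac{\theta}{\alpha}}\diamond C_\theta)\big)^\sharp=(A^{\theta,\alpha}_\varphi\oplus\alpha A^{\theta,\frac{\theta}{\alpha}}_\varphi)(C_{\alpha,\frac{\theta}{\alpha}}\diamond C_\theta)$.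
   Context: $L^2=L^2(\mathbb{T},m)$ with $m$ normalized Lebesgue measure on the unit circle; $H^2\subset L^2$ is the Hardy space of the unit disc. An inner function is $\theta\in H^\infty$ with $|\theta|=1$ a.e. on $\mathbb{T}$; $K_\theta=H^2\ominus\theta H^2$ ($=\{0\}$ if $\theta$ is constant), $P_\theta$ is the orthogonal projection of $L^2$ onto $K_\theta$, and $K_\theta^\infty=K_\theta\cap H^\infty$, which is dense in $K_\theta$. $\alpha\leqslant\theta$ means $\frac{\theta}{\alpha}$ is inner; then $K_\theta=K_\alpha\oplus\alpha K_{\frac{\theta}{\alpha}}$ orthogonally. For inner functions $\theta,\alpha$ and $\varphi\in L^2$, the asymmetric truncated Toeplitz operator $A^{\theta,\alpha}_\varphi$ is $A^{\theta,\alpha}_\varphi f=P_\alpha(\varphi f)$ on $\{f\in K_\theta:\varphi f\in L^2\}\supset K_\theta^\infty$; if bounded, it is identified with its unique bounded extension $K_\theta\to K_\alpha$. $C_\theta f=\theta\bar z\bar f$ ($f\in L^2$) is a conjugation (antilinear isometric involution) preserving $K_\theta$; $C_{\alpha,\frac{\theta}{\alpha}}$ is the conjugation on $K_\theta$ given by $C_{\alpha,\frac{\theta}{\alpha}}(f_1+\alpha f_2)=C_\alpha f_1+\alpha C_{\frac{\theta}{\alpha}}f_2$ for $f_1\in K_\alpha$, $f_2\in K_{\frac{\theta}{\alpha}}$. For operators (linear or antilinear) $X_i\colon\mathcal{H}\to\mathcal{K}_i$ and $Y_i\colon\mathcal{K}_i\to\mathcal{H}$, $i=1,2$: $(X_1\diamond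 X_2)f=X_1f\oplus X_2f$ maps $\mathcal{H}$ to $\mathcal{K}_1\oplus\mathcal{K}_2$, and $(Y_1\boxplus Y_2)(f\oplus g)=Y_1f+Y_2g$ maps $\mathcal{K}_1\oplus\mathcal{K}_2$ to $\mathcal{H}$; $X\oplus Y$ acts componentwise. An expression $\alpha A$ or $A\overline{\alpha}$ means composition with multiplication by $\alpha$ or $\overline{\alpha}$. Throughout, $K_\alpha\oplus\alpha K_{\frac{\theta}{\alpha}}$ is identified with $K_\theta$: thus $A^{\theta,\alpha}_\varphi\diamond\alpha A^{\theta,\frac{\theta}{\alpha}}_{\psi}$ is the operator $f\mapsto A^{\theta,\alpha}_\varphi f+\alpha A^{\theta,\frac{\theta}{\alpha}}_\psi f$ on $K_\theta$; $A^{\alpha,\theta}_{\overline{\varphi}}\boxplus A^{\frac{\theta}{\alpha},\theta}_{\psi}\overline{\alpha}$ is the operator $f_1+\alpha f_2\mapsto A^{\alpha,\theta}_{\overline{\varphi}}f_1+A^{\frac{\theta}{\alpha},\theta}_\psi f_2$ on $K_\theta$; $A^{\theta,\alpha}_\varphi\oplus\alpha A^{\theta,\frac{\theta}{\alpha}}_\varphi\colon K_\theta\oplus K_\theta\to K_\alpha\oplus\alpha K_{\frac{\theta}{\alpha}}=K_\theta$; and $A^{\alpha,\theta}_{\overline{\varphi}}\oplus A^{\frac{\theta}{\alpha},\theta}_{\overline{\varphi}}\overline{\alpha}\colon K_\theta=K_\alpha\oplus\alpha K_{\frac{\theta}{\alpha}}\to K_\theta\oplus K_\theta$. For a bounded antilinear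 $X\colon\mathcal{H}\to\mathcal{K}$, its antilinear adjoint $X^\sharp\colon\mathcal{K}\to\mathcal{H}$ is the unique antilinear operator with $\langle Xf,g\rangle=\overline{\langle f,X^\sharp g\rangle}$ for all $f\in\mathcal{H}$, $g\in\mathcal{K}$. *)

(* Defs.v *)
From mathcomp Require Import all_boot all_order all_algebra.
From mathcomp Require Import all_classical all_reals all_analysis.
From mathcomp Require Export complex.

Set Implicit Arguments.
Unset Strict Implicit.
Unset Printing Implicit Defensive.
Import Order.TTheory GRing.Theory Num.Theory.

Local Open Scope classical_set_scope.
Local Open Scope ring_scope.
Local Open Scope complex_scope.

(* A function on the unit circle is given as a function of the angle t, the
   point of the circle being z = e^(it). The measure circm is dt / (2 pi) on
   [0, 2 pi], so values outside that interval are irrelevant. Elements of L^2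
   are represented by functions, and equality in L^2 is equality a.e. *)

Definition circ (R : realType) : Type := R -> R[i].

Section Circle.
Context {R : realType}.

Lemma two_pi_gt0 : (0 : R) < 2 * pi.
Proof. by rewrite mulr_gt0 ?pi_gt0 ?ltr0n. Qed.

Definition circm : probability (measurableTypeR R) R := uniform_prob two_pi_gt0.

Definition zvar : circ R := fun t => cos t +i* sin t.

Definition fadd (f g : circ R) : circ R := fun t => f t + g t.
Definition fsub (f g : circ R) : circ R := fun t => f t - g t.
Definition fscale (c : R[i]) (f : circ R) : circ R := fun t => c * f t.
Definition fmul (f g : circ R) : circ R := fun t => f t * g t.
Definition fdiv (f g : circ R) : circ R := fun t => f t / g t.
Definition fconj (f : circ R) : circ R := fun t => (f t)^*.
Definition fexp (f : circ R) (n : nat) : circ R := fun t => f t ^+ n.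
Definition fzero : circ R := fun _ => 0.

Definition eqm (f g : circ R) : Prop := f = g %[ae circm].

Definition Lp (p : \bar R) (f : circ R) : Prop :=
  (fun t => complex.Re (f t)) \in Lfun circm p /\
  (fun t => complex.Im (f t)) \in Lfun circm p.
Definition L2 : set (circ R) := [set f | Lp 2%:E f].
Definition Linfty : set (circ R) := [set f | Lp +oo%E f].

Definition cintegral (f : circ R) : R[i] :=
  Rintegral circm setT (fun t => complex.Re (f t)) +i*
  Rintegral circm setT (fun t => complex.Im (f t)).
Definition inner (f g : circ R) : R[i] := cintegral (fmul f (fconj g)).
Definition norm2 (f : circ R) : R := Num.sqrt (complex.Re (inner f f)).

(* The Hardy spaces as spaces of boundary functions: the Fourier coefficients
   of negative index vanish. *)
Definition H2 : set (circ R) :=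
  [set f | L2 f /\ forall n : nat, inner f (fconj (fexp zvar n.+1)) = 0].
Definition Hinfty : set (circ R) := H2 `&` Linfty.

Definition inner_function (theta : circ R) : Prop :=
  Hinfty theta /\ {ae circm, forall t, `|theta t| = 1}.
Definition nonconstant (f : circ R) : Prop :=
  ~ exists c : R[i], eqm f (fun _ => c).
(* alpha <= theta *)
Definition inner_divides (alpha theta : circ R) : Prop :=
  inner_function (fdiv theta alpha).

Definition Ksp (theta : circ R) : set (circ R) :=
  [set f | H2 f /\ forall h, H2 h -> inner f (fmul theta h) = 0].

Definition op := circ R -> circ R.

Definition op_eq (H : set (circ R)) (X Y : op) : Prop :=
  forall f, H f -> eqm (X f) (Y f).

Definition mulop (g : circ R) : op := fmul g.

(* Operators between subspaces H and H' of L^2; the clauses hold modulo a.e.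
   equality. *)
Definition linear_on (H H' : set (circ R)) (X : op) : Prop :=
  (forall f, H f -> H' (X f)) /\
  (forall (c : R[i]) f g, H f -> H g ->
     eqm (X (fadd (fscale c f) g)) (fadd (fscale c (X f)) (X g))).
Definition antilinear_on (H H' : set (circ R)) (X : op) : Prop :=
  (forall f, H f -> H' (X f)) /\
  (forall (c : R[i]) f g, H f -> H g ->
     eqm (X (fadd (fscale c f) g)) (fadd (fscale c^* (X f)) (X g))).
Definition bounded_on (D : set (circ R)) (X : op) : Prop :=
  exists M : R, forall f, D f -> norm2 (X f) <= M * norm2 f.

(* The orthogonal projection of L^2 onto Ksp theta. *)
Definition proj (theta : circ R) : op := fun f =>
  xget fzero
    [set g | Ksp theta g /\
             forall h, Ksp theta h -> inner (fsub f g) h = 0].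

(* The operator f |-> P_alpha (phi f) on its natural domain. *)
Definition att_dom (theta phi : circ R) : set (circ R) :=
  [set f | Ksp theta f /\ L2 (fmul phi f)].
Definition att_pre (alpha phi : circ R) : op := fun f => proj alpha (fmul phi f).
Definition att_bounded (theta alpha phi : circ R) : Prop :=
  bounded_on (att_dom theta phi) (att_pre alpha phi).

(* A^{theta,alpha}_phi : Ksp theta -> Ksp alpha, the bounded linear extension of
   that operator; the default value is used only if there is none. *)
Definition att (theta alpha phi : circ R) : op :=
  xget (fun _ => fzero)
    [set A : op | linear_on (Ksp theta) (Ksp alpha) A /\
                  bounded_on (Ksp theta) A /\
                  op_eq (att_dom theta phi) A (att_pre alpha phi)].

Definition conjugation (theta : circ R) : op := fun f =>
  fmul theta (fmul (fconj zvar) (fconj f)).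

(* (f1, f2) with f = f1 + alpha f2, f1 in Ksp alpha and f2 in Ksp beta; for
   beta = theta / alpha and f in Ksp theta the pair is unique modulo a.e.
   equality. *)
Definition components (alpha beta : circ R) (f : circ R) : circ R * circ R :=
  xget (fzero, fzero)
    [set p | Ksp alpha p.1 /\ Ksp beta p.2 /\ eqm f (fadd p.1 (fmul alpha p.2))].

(* The identification of Ksp theta with Ksp alpha (+) alpha Ksp (theta / alpha),
   in both directions. *)
Definition to_sum (alpha beta : circ R) (f : circ R) : circ R * circ R :=
  ((components alpha beta f).1, fmul alpha (components alpha beta f).2).
Definition of_sum (p : circ R * circ R) : circ R := fadd p.1 p.2.

Definition conjugation2 (alpha beta : circ R) : op := fun f =>
  fadd (conjugation alpha (components alpha beta f).1)
       (fmul alpha (conjugation beta (components alpha beta f).2)).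

Definition diamond (X1 X2 : op) (f : circ R) : circ R * circ R :=
  (X1 f, X2 f).
Definition boxplus (Y1 Y2 : op) (p : circ R * circ R) : circ R :=
  fadd (Y1 p.1) (Y2 p.2).
Definition oplus (X Y : op) (p : circ R * circ R) : circ R * circ R :=
  (X p.1, Y p.2).

(* The antilinear adjoint of X : H -> H', an operator H' -> H. If the set is
   nonempty its element is unique on H' modulo a.e. equality. The default value
   0 is harmless in an equation sharp H H X = X on H: if the set were empty, X
   would vanish on H, and then 0 would be in the set. *)
Definition sharp (H H' : set (circ R)) (X : op) : op :=
  xget (fun _ => fzero)
    [set Y : op | antilinear_on H' H Y /\
       forall f g, H f -> H' g -> inner (X f) g = (inner f (Y g))^*].

End Circle.

Arguments op R : clear implicits.
Arguments circm R : clear implicits.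

(* Main.v *)
Require Import Defs.
From mathcomp Require Import all_boot all_order all_algebra.
From mathcomp Require Import all_classical all_reals all_analysis.
From mathcomp Require Import measurable_realfun ring lra.


(* Each left-hand side is of the form [X f = A (C1 f) + alpha * B (C2 f)], with
   [A], [B] compressions of the multiplications by [phi] and [psi] and [C1], [C2]
   conjugations. For bounded [f = f1 + alpha * f2] and [g = g1 + alpha * g2] the
   form [<X f, g>] is an integral that is symmetric in [f] and [g]; in case (1)
   it is the integral of [phi * theta * conj (z * f * g)]. Bounded functions are
   dense in the model spaces, so [X] is antilinearly selfadjoint. As the adjoint
   of [A] is the operator with symbol [conj phi], the right-hand side [Y]
   satisfies [<Y f, g> = <X g, f>] too, hence [Y = X].

   Density: the projection of [z^n] on the model space is [z^n - theta * p] for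
   a polynomial [p], and an element orthogonal to all these bounded functions
   has no nonzero Fourier coefficient. Such a function [f] vanishes: multiplying
   it by polynomials in [cos (t - b / 2)] that converge boundedly to the
   indicator of an arc, one sees that [f] has integral 0 over [0, b] for all
   [b]. *)

Set Implicit Arguments.
Unset Strict Implicit.
Unset Printing Implicit Defensive.
Import Order.TTheory GRing.Theory Num.Theory.
Import numFieldNormedType.Exports.

Local Open Scope classical_set_scope.
Local Open Scope ring_scope.
Local Open Scope complex_scope.

Local Notation Re := complex.Re.
Local Notation Im := complex.Im.

(** * Square-integrable functions on the circle *)

(** As [phi] is only in L2, the forms are explicit integrals only on functions for which the
    products stay in L2; elsewhere the operators are known only as continuous extensions. Hence the
    detour through bounded functions. Reproducing kernels, the usual bounded elements of a model
    space, rest on point evaluation in the disc, whereas [H2] consists here of boundary functions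
    described by Fourier coefficients; the projections of [z^n] take their place. They are bounded
    because [conj theta * z^n] has only finitely many nonnegative frequencies. Uniqueness of Fourier
    coefficients is also what makes [H2] stable under multiplication by inner functions: an L2
    function orthogonal to all [z^n] is orthogonal to [H2]. Projections, components, operators and
    adjoints are all chosen by specification. Their existence rests on the completeness of L2. Since
    elements are functions and not classes, compatibility of the operators with a.e. equality must
    be derived, and boundedness gives it. *)

Section Lfun2.
Context d {T : measurableType d} {R : realType}.
Variable P : {measure set T -> \bar R}.

Lemma Lfun2P (f : T -> R) : f \in Lfun P 2%:E <->
  measurable_fun setT f /\ P.-integrable setT (EFin \o (fun x => f x ^+ 2)).
Proof.
split=> [f2|[mf if2]].
  split; last exact: Lfun2_integrable_sqr.
  by move: f2; rewrite inE => /andP[]; rewrite inE.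
rewrite inE; apply/andP; split; rewrite inE//= /finite_norm unlock.
apply: poweR_lty; case/integrableP: if2 => _; apply: le_lt_trans.
rewrite le_eqVlt; apply/orP; left; apply/eqP; apply: eq_integral => x _ /=.
by rewrite -real_normK ?num_real// powR_mulrn// normrX normr_id.
Qed.

End Lfun2.

(** * Complex arithmetic and the squared modulus *)

Section Complex.
Context {R : realType}.
Implicit Types x y : R[i].

Lemma conjcD x y : (x + y)^*%C = x^*%C + y^*%C. Proof. exact: rmorphD. Qed.
Lemma conjcB x y : (x - y)^*%C = x^*%C - y^*%C. Proof. exact: rmorphB. Qed.
Lemma conjcM x y : (x * y)^*%C = x^*%C * y^*%C. Proof. exact: rmorphM. Qed.
Lemma conjcX x n : (x ^+ n)^*%C = x^*%C ^+ n. Proof. exact: rmorphXn. Qed.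

(** The squared modulus with values in [R], whereas the norm of [x] lies in [R[i]]; squares keep the
    later estimates polynomial. *)
Definition cabs2 x : R := Re x ^+ 2 + Im x ^+ 2.

Lemma cabs2_ge0 x : 0 <= cabs2 x.
Proof. by rewrite addr_ge0 ?sqr_ge0. Qed.

Lemma cabs2M x y : cabs2 (x * y) = cabs2 x * cabs2 y.
Proof. by case: x y => [a b] [c e]; rewrite /cabs2 /=; ring. Qed.

Lemma cabs2J x : cabs2 x^*%C = cabs2 x.
Proof. by case: x => [a b]; rewrite /cabs2 /= sqrrN. Qed.

Lemma cabs2E x : (cabs2 x)%:C = x * x^*%C.
Proof. by case: x => [a b]; rewrite /cabs2; simpc; congr (_ +i* _); ring. Qed.

Lemma cabs2N x : cabs2 (- x) = cabs2 x.
Proof. by case: x => a b; rewrite /cabs2 /= !sqrrN. Qed.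

Lemma cabs2R (a : R) : cabs2 a%:C = a ^+ 2.
Proof. by rewrite /cabs2 /= expr0n addr0. Qed.

Lemma cabs2D_le x y : cabs2 (x + y) <= 2 * cabs2 x + 2 * cabs2 y.
Proof.
case: x y => [a b] [c e]; rewrite /cabs2 /=.
have := sqr_ge0 (a - c); have := sqr_ge0 (b - e); nra.
Qed.

Lemma cabs2_eq0 x : cabs2 x = 0 -> x = 0.
Proof.
case: x => a b; rewrite /cabs2 /= => /eqP.
by rewrite paddr_eq0 ?sqr_ge0// !expf_eq0/= => /andP[/eqP-> /eqP->].
Qed.

Lemma norm1_cabs2 x : (`|x| = 1) <-> cabs2 x = 1.
Proof.
split=> [h|h].
  by apply: (@complexI R); rewrite add_Re2_Im2 h expr1n.
by rewrite normc_def -/(cabs2 x) h sqrtr1.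
Qed.

Lemma creD x y : Re (x + y) = Re x + Re y. Proof. by case: x y => ? ? []. Qed.
Lemma cimD x y : Im (x + y) = Im x + Im y. Proof. by case: x y => ? ? []. Qed.
Lemma creN x : Re (- x) = - Re x. Proof. by case: x. Qed.
Lemma cimN x : Im (- x) = - Im x. Proof. by case: x. Qed.
Lemma creM x y : Re (x * y) = Re x * Re y - Im x * Im y.
Proof. by case: x y => ? ? []. Qed.
Lemma cimM x y : Im (x * y) = Re x * Im y + Im x * Re y.
Proof. by case: x y => ? ? []. Qed.
Lemma creJ x : Re x^*%C = Re x. Proof. by case: x. Qed.
Lemma cimJ x : Im x^*%C = - Im x. Proof. by case: x. Qed.

Lemma normr_ReM x y : `|Re (x * y)| <= cabs2 x + cabs2 y.
Proof.
case: x y => [a b] [c e]; rewrite /cabs2 /= ler_norml.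
have := sqr_ge0 (a - c); have := sqr_ge0 (b - e).
by have := sqr_ge0 (a + c); have := sqr_ge0 (b + e); move=> *; nra.
Qed.

Lemma normr_ImM x y : `|Im (x * y)| <= cabs2 x + cabs2 y.
Proof.
case: x y => [a b] [c e]; rewrite /cabs2 /= ler_norml.
have := sqr_ge0 (a - e); have := sqr_ge0 (b - c).
by have := sqr_ge0 (a + e); have := sqr_ge0 (b + c); move=> *; nra.
Qed.

End Complex.

(** * Measurability, integrability and the space L2 *)

Section Basics.
Context {R : realType}.
Notation mu := (circm R).
Implicit Types f g h : circ R.

Definition cmeas f := measurable_fun [set: measurableTypeR R] (fun t => Re (f t)) /\
  measurable_fun [set: measurableTypeR R] (fun t => Im (f t)).

Definition cint f := mu.-integrable setT (EFin \o (fun t => Re (f t))) /\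
  mu.-integrable setT (EFin \o (fun t => Im (f t))).

Lemma cmeasD f g : cmeas f -> cmeas g -> cmeas (fadd f g).
Proof.
move=> [? ?] [? ?]; split; rewrite /fadd.
  by under eq_fun do rewrite creD; exact: measurable_funD.
by under eq_fun do rewrite cimD; exact: measurable_funD.
Qed.

Lemma cmeasM f g : cmeas f -> cmeas g -> cmeas (fmul f g).
Proof.
move=> [? ?] [? ?]; split; rewrite /fmul.
  under eq_fun do rewrite creM.
  by apply: measurable_funB; exact: measurable_funM.
under eq_fun do rewrite cimM.
by apply: measurable_funD; exact: measurable_funM.
Qed.

Lemma cmeasJ f : cmeas f -> cmeas (fconj f).
Proof.
move=> [? ?]; split; rewrite /fconj.
  by under eq_fun do rewrite creJ.
by under eq_fun do rewrite cimJ; exact: measurableT_comp.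
Qed.

Lemma cmeas_cst (c : R[i]) : cmeas (fun=> c).
Proof. by split; exact: measurable_cst. Qed.

Lemma cmeasZ c f : cmeas f -> cmeas (fscale c f).
Proof. exact: (@cmeasM (fun=> c)) (cmeas_cst c). Qed.

Lemma fsubE f g : fsub f g = fadd f (fscale (-1) g).
Proof. by apply/funext => t; rewrite /fsub /fadd /fscale mulN1r. Qed.

Lemma cmeasB f g : cmeas f -> cmeas g -> cmeas (fsub f g).
Proof. by move=> ? ?; rewrite fsubE; apply/cmeasD/cmeasZ. Qed.

Lemma cmeas_cabs2 f : cmeas f ->
  measurable_fun [set: measurableTypeR R] (fun t => cabs2 (f t)).
Proof. by case=> ? ?; apply: measurable_funD; exact: measurable_funX. Qed.

Lemma L2P f :
  L2 f <-> cmeas f /\ mu.-integrable setT (EFin \o (fun t => cabs2 (f t))).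
Proof.
split=> [[/Lfun2P[mr ir] /Lfun2P[mi ii]]|[[mr mi] iab]].
  by split => //; have := integrableD measurableT ir ii.
by split; apply/Lfun2P; split => //; apply: le_integrable iab => //;
  do ?[by apply/measurable_EFinP; exact: measurable_funX];
  move=> t _ /=; rewrite lee_fin !ger0_norm ?cabs2_ge0 ?sqr_ge0// /cabs2;
  rewrite ?lerDl ?lerDr sqr_ge0.
Qed.

Lemma L2_cmeas f : L2 f -> cmeas f. Proof. by move=> /L2P[]. Qed.

Lemma aeS (P Q : R -> Prop) : (forall t, P t -> Q t) ->
  {ae mu, forall t, P t} -> {ae mu, forall t, Q t}.
Proof.
by move=> PQ; apply: filterS => //; exact: (ae_filter_ringOfSetsType mu).
Qed.

Lemma aeS2 (P Q S : R -> Prop) : (forall t, P t -> Q t -> S t) ->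
  {ae mu, forall t, P t} -> {ae mu, forall t, Q t} -> {ae mu, forall t, S t}.
Proof.
by move=> PQ; apply: filterS2 => //; exact: (ae_filter_ringOfSetsType mu).
Qed.

Lemma eqmP f g : eqm f g <-> {ae mu, forall t, f t = g t}.
Proof. by split; apply: aeS => // t; exact. Qed.

Lemma eqm_sym f g : eqm f g -> eqm g f.
Proof. by move=> /eqmP fg; apply/eqmP; apply: aeS fg. Qed.

Lemma eqm_trans f g h : eqm f g -> eqm g h -> eqm f h.
Proof.
by move=> /eqmP fg /eqmP gh; apply/eqmP; apply: aeS2 fg gh => t ->.
Qed.

Lemma eqm_refl f : eqm f f.
Proof. by apply/eqmP; exact: aeW. Qed.

Lemma integrable_ae_le (f g : measurableTypeR R -> \bar R) :
  measurable_fun setT f ->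
  {ae mu, forall t, (`|f t| <= `|g t|)%E} ->
  mu.-integrable setT g -> mu.-integrable setT f.
Proof.
move=> mf fg /integrableP[mg goo]; apply/integrableP; split => //.
apply: le_lt_trans goo; apply: ae_ge0_le_integral => //;
  do ?exact: measurableT_comp.
by apply: aeS fg.
Qed.

Lemma L2_dom (M : R) f g : L2 f -> cmeas g ->
  {ae mu, forall t, cabs2 (g t) <= M * cabs2 (f t)} -> L2 g.
Proof.
move=> /L2P[mf iff] mg gf; apply/L2P; split => //.
apply: (@integrable_ae_le _ (fun t => M%:E * (cabs2 (f t))%:E)%E).
- by apply/measurable_EFinP; exact: cmeas_cabs2.
- apply: aeS gf => t gf /=.
  rewrite lee_fin ger0_norm ?cabs2_ge0//; exact: le_trans gf (ler_norm _).
- exact: (@integrableZl _ _ _ mu _ measurableT M).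
Qed.

Lemma L2D f g : L2 f -> L2 g -> L2 (fadd f g).
Proof.
move=> /L2P[mf iff] /L2P[mg ig]; apply/L2P; split; first exact: cmeasD.
apply: (@le_integrable _ _ _ mu _ measurableT _
  (fun t => 2%:E * (cabs2 (f t))%:E + 2%:E * (cabs2 (g t))%:E)%E).
- by apply/measurable_EFinP; exact: cmeas_cabs2 (cmeasD mf mg).
- move=> t _ /=; rewrite lee_fin ger0_norm ?cabs2_ge0//.
  by apply: le_trans (ler_norm _); exact: cabs2D_le.
- by apply: integrableD => //; exact: (@integrableZl _ _ _ mu).
Qed.

Lemma L2_bndM f g (M : R) : cmeas g -> {ae mu, forall t, cabs2 (g t) <= M} ->
  L2 f -> L2 (fmul g f).
Proof.
move=> mg gM f2; have mf := L2_cmeas f2.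
apply: (@L2_dom M _ _ f2); first exact: cmeasM.
apply: aeS gM => t gM.
by rewrite cabs2M ler_wpM2r// cabs2_ge0.
Qed.

Lemma L2Z c f : L2 f -> L2 (fscale c f).
Proof.
by apply: (@L2_bndM _ _ (cabs2 c)); [exact: cmeas_cst | apply: aeW].
Qed.

Lemma L2B f g : L2 f -> L2 g -> L2 (fsub f g).
Proof. by move=> ? ?; rewrite fsubE; apply/L2D/L2Z. Qed.

Lemma L2J f : L2 f -> L2 (fconj f).
Proof.
move=> f2; apply: (@L2_dom 1 _ _ f2); first exact/cmeasJ/L2_cmeas.
by apply: aeW => t; rewrite cabs2J mul1r.
Qed.

Lemma L2_cst (c : R[i]) : L2 (fun=> c).
Proof.
apply/L2P; split; first exact: cmeas_cst.
apply: (@measurable_bounded_integrable _ _ _ mu) => //.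
  by rewrite (le_lt_trans (probability_le1 _ _))// ltry.
exists (cabs2 c); split; first exact: num_real.
by move=> x xc t _ /=; rewrite ger0_norm ?cabs2_ge0 // ltW.
Qed.

Lemma L2_fzero : L2 (fzero : circ R). Proof. exact: L2_cst. Qed.

Lemma L2M_cint f g : L2 f -> L2 g -> cint (fmul f g).
Proof.
move=> /L2P[mf iff] /L2P[mg ig]; have [mr mi] := cmeasM mf mg.
have iS : mu.-integrable setT
  (fun t => (cabs2 (f t))%:E + (cabs2 (g t))%:E)%E by exact: integrableD.
by split; apply: le_integrable iS => //; do ?exact/measurable_EFinP;
  move=> t _ /=; rewrite lee_fin; apply: le_trans (ler_norm _);
  [exact: normr_ReM | exact: normr_ImM].
Qed.

Lemma cintegralD f g : cint f -> cint g ->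
  cintegral (fadd f g) = cintegral f + cintegral g.
Proof.
move=> [fr fi] [gr gi]; rewrite /cintegral /fadd.
under eq_Rintegral do rewrite creD; rewrite RintegralD//.
by under [X in _ +i* X]eq_Rintegral do rewrite cimD; rewrite RintegralD//.
Qed.

Lemma cintegralZ c f : cint f -> cintegral (fscale c f) = c * cintegral f.
Proof.
move=> [fr fi]; case: c => a b; rewrite /cintegral /fscale.
have iZ (k : R) (u : measurableTypeR R -> R) : mu.-integrable setT (EFin \o u) ->
    mu.-integrable setT (EFin \o (fun t => k * u t)).
  by move=> iu; exact: (@integrableZl _ _ _ mu _ measurableT k _ iu).
under eq_Rintegral do rewrite creM; rewrite RintegralB//; do ?exact: iZ.
under [X in _ +i* X]eq_Rintegral do rewrite cimM.
rewrite RintegralD//; do ?exact: iZ.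
by rewrite !RintegralZl.
Qed.

Lemma cintegralJ f : cint f -> cintegral (fconj f) = (cintegral f)^*%C.
Proof.
move=> [fr fi]; rewrite /cintegral /fconj.
under eq_Rintegral do rewrite creJ.
under [X in _ +i* X]eq_Rintegral do rewrite cimJ -mulN1r.
by rewrite RintegralZl// mulN1r.
Qed.

Lemma cintegral_eqm f g : cmeas f -> cmeas g -> eqm f g ->
  cintegral f = cintegral g.
Proof.
move=> [fr fi] [gr gi] fg; rewrite /cintegral /Rintegral.
congr (fine _ +i* fine _); apply: ae_eq_integral => //;
  do ?[exact/measurable_EFinP]; by apply: aeS fg => t /[apply] /= ->.
Qed.

End Basics.

(** * Completeness of L2 *)

Section RieszFischer.
Context d {T : measurableType d} {R : realType}.
Variable P : probability T R.

Lemma le_integral_norm_sqr (u : T -> R) (w : R) : 0 < w ->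
  measurable_fun setT u ->
  (\int[P]_x ((u x) ^+ 2)%:E <= (w ^+ 2)%:E -> \int[P]_x `|u x|%:E <= w%:E)%E.
Proof.
move=> w0 mu uw.
have mu2 : measurable_fun setT (fun x => u x ^+ 2) by exact: measurable_funX.
(* AM-GM: [|u| <= u^2 / (2 w) + w / 2] *)
apply: (@le_trans _ _ (\int[P]_x ((2 * w)^-1%:E * (u x ^+ 2)%:E + (w / 2)%:E))%E).
  apply: ge0_le_integral => //.
  - by apply/measurable_EFinP; exact: measurableT_comp.
  - apply: emeasurable_funD => //; apply: emeasurable_funM => //.
    exact/measurable_EFinP.
  - move=> x _; rewrite -EFinM -EFinD lee_fin.
    rewrite -subr_ge0.
    have -> : (2 * w)^-1 * u x ^+ 2 + w / 2 - `|u x| =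
        (2 * w)^-1 * (`|u x| - w) ^+ 2.
      rewrite -[u x ^+ 2]real_normK ?num_real//.
      by field; rewrite gt_eqF.
    by rewrite mulr_ge0 ?sqr_ge0// invr_ge0 mulr_ge0// ltW.
rewrite ge0_integralD//; last 3 first.
- by move=> x _; rewrite -EFinM lee_fin mulr_ge0 ?sqr_ge0// invr_ge0 mulr_ge0// ltW.
- by apply: emeasurable_funM => //; exact/measurable_EFinP.
- by move=> x _; rewrite lee_fin divr_ge0// ltW.
rewrite ge0_integralZl_EFin//; last 3 first.
- by move=> x _; rewrite lee_fin sqr_ge0.
- exact/measurable_EFinP.
- by rewrite invr_ge0 mulr_ge0// ltW.
rewrite integral_cst// [X in (_ + _ * X <= _)%E](_ : _ = 1%E) ?mule1; last exact: probability_setT.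
apply: (@le_trans _ _ ((2 * w)^-1%:E * (w ^+ 2)%:E + (w / 2)%:E)%E).
  by rewrite leeD2r// lee_wpmul2l// lee_fin invr_ge0 mulr_ge0// ltW.
rewrite -EFinM -EFinD lee_fin le_eqVlt; apply/orP; left; apply/eqP.
by field; rewrite gt_eqF.
Qed.

(* The increments of a fast subsequence are summable in L1, so that it converges
   almost everywhere; Fatou's lemma turns this into convergence in L2. *)
Lemma riesz_fischer (u : nat -> T -> R) :
  (forall n, measurable_fun setT (u n)) ->
  (forall e : R, 0 < e -> exists N, forall m n, (N <= m)%N -> (N <= n)%N ->
     (\int[P]_x ((u m x - u n x) ^+ 2)%:E <= e%:E)%E) ->
  exists f : T -> R, measurable_fun setT f /\
    (forall e : R, 0 < e -> exists N, forall n, (N <= n)%N ->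
     (\int[P]_x ((u n x - f x) ^+ 2)%:E <= e%:E)%E).
Proof.
move=> mu cu.
(* The numbers [w k] sum to 1. The Cauchy property is invoked with [w k ^+ 2] because it bounds
   squared norms, while the L1 norms of the increments are then at most [w k]. *)
pose w k : R := ((2 ^ k.+1)%:R)^-1.
have w0 k : 0 < w k by rewrite invr_gt0 ltr0n expn_gt0.
have [N NP] := @choice _ _ (fun k N => forall m n, (N <= m)%N -> (N <= n)%N ->
     (\int[P]_x ((u m x - u n x) ^+ 2)%:E <= (w k ^+ 2)%:E)%E)
  (fun k => cu _ (exprn_gt0 2 (w0 k))).
(* The maximum puts both [M k] and [M k.+1] beyond [N k]; the summand [k] makes [M] tend to
   infinity, so that [M (k + K)] is at least [K] at the end. *)
pose M k := (k + \max_(j < k.+1) N j)%N.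
have NM k j : (j <= k)%N -> (N j <= M k)%N.
  move=> jk; apply: leq_trans (leq_addl _ _).
  by apply: (@leq_bigmax _ (fun i : 'I_k.+1 => N i) (Ordinal (jk : (j < k.+1)%N))).
pose v k := u (M k).
have mv k : measurable_fun setT (v k) by exact: mu.
pose g k x := `|v k.+1 x - v k x|.
have g0 k x : (0 <= (g k x)%:E)%E by rewrite lee_fin normr_ge0.
have mg k : measurable_fun setT (EFin \o g k).
  by apply/measurable_EFinP; apply: measurableT_comp => //; exact: measurable_funB.
have gw k : (\int[P]_x (g k x)%:E <= (w k)%:E)%E.
  apply: le_integral_norm_sqr => //; first exact: measurable_funB.
  by apply: NP; exact: NM.
have ig : (\int[P]_x \sum_(k <oo) (g k x)%:E < +oo)%E.
  rewrite integral_nneseries//.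
  apply: (@le_lt_trans _ _ 1%:E); last by rewrite ltry.
  apply: le_trans (@epsilon_trick0 _ 1 xpredT ler01).
  apply: lee_nneseries; first by move=> k _ _; exact: integral_ge0.
  by move=> k _; rewrite div1r; exact: gw.
have aeg : {ae P, forall x, \sum_(k <oo) (g k x)%:E < +oo}%E.
  have : P.-integrable setT (fun x => \sum_(k <oo) (g k x)%:E)%E.
    apply/integrableP; split.
      by apply: ge0_emeasurable_sum => [k x _ _|k _]; [exact: g0|exact: mg].
    apply: le_lt_trans ig; rewrite le_eqVlt; apply/orP; left; apply/eqP.
    by apply: eq_integral => x _; rewrite gee0_abs// nneseries_ge0.
  move=> /(integrable_ae measurableT); apply: filterS => x /(_ I); rewrite ge0_fin_numE//.
  by apply: nneseries_ge0.
have vcvg x : (\sum_(k <oo) (g k x)%:E < +oo)%E -> cvgn (v ^~ x).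
  move=> gx.
  have cs : cvgn (series (telescope (v ^~ x))).
    apply: normed_cvg; apply: nondecreasing_is_cvgn.
      by apply/nondecreasing_series => n _ _ /=; exact: normr_ge0.
    exists (fine (\sum_(k <oo) (g k x)%:E)%E) => _ [n _ <-].
    rewrite -lee_fin fineK; last by rewrite ge0_fin_numE ?nneseries_ge0.
    rewrite /series/= -sumEFin.
    apply: (@nneseries_lim_ge _ (fun k => (g k x)%:E) xpredT 0 n) => k _ _; exact: g0.
  rewrite [X in cvg (X @ _)](_ : _ =
      (fun k => v 0%N x + series (telescope (v ^~ x)) k)); last first.
    by apply/funext => k; rewrite [LHS](eq_sum_telescope (v ^~ x)).
  by apply: is_cvgD => //; exact: is_cvg_cst.
(* The upper limit is measurable without any convergence, and it is the limit at almost every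
   point. *)
pose f x := fine (limn_esup (fun k => (v k x)%:E)).
have vf x : (\sum_(k <oo) (g k x)%:E < +oo)%E -> v k x @[k --> \oo] --> f x.
  move=> /vcvg cv.
  suff -> : f x = limn (v ^~ x) by [].
  rewrite /f limn_esup_lim.
  have /cvg_esups/cvg_lim -> // : (v k x)%:E @[k --> \oo] --> (limn (v ^~ x))%:E.
  by apply/fine_cvgP; split; [exact: nearW | exact: cv].
have mf : measurable_fun setT f.
  apply: measurableT_comp => //; apply: measurable_fun_limn_esup => n.
  exact/measurable_EFinP.
exists f; split => // e e0; have [K KP] := cu _ e0; exists K => n Kn.
have mh k : measurable_fun setT (fun x => ((u n x - v k x) ^+ 2)%:E).
  by apply/measurable_EFinP/measurable_funX/measurable_funB.
have h0 k x : setT x -> (0 <= ((u n x - v k x) ^+ 2)%:E)%E.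
  by rewrite lee_fin sqr_ge0.
have mliminf : measurable_fun setT
    (fun x => limn_einf (fun k => ((u n x - v k x) ^+ 2)%:E)).
  rewrite /limn_einf; apply: measurableT_comp => //.
  apply: measurable_fun_limn_esup => k.
  by apply: measurableT_comp => //; exact: mh.
have -> : (\int[P]_x ((u n x - f x) ^+ 2)%:E =
    \int[P]_x limn_einf (fun k => ((u n x - v k x) ^+ 2)%:E))%E.
  apply: ae_eq_integral => //.
    by apply/measurable_EFinP/measurable_funX/measurable_funB.
  apply: filterS aeg => x /vf vx _.
  suff /cvg_limn_einf_sup[-> _] :
    ((u n x - v k x) ^+ 2)%:E @[k --> \oo] --> ((u n x - f x) ^+ 2)%:E by [].
  apply/fine_cvgP; split; first exact: nearW.
  have cuv : u n x - v k x @[k --> \oo] --> u n x - f x.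
    by apply: cvgB => //; exact: cvg_cst.
  exact: (cvgM cuv cuv).
apply: le_trans (fatou P measurableT mh h0) _.
rewrite limn_einf_lim; apply: lime_le; first exact: is_cvg_einfs.
(* The infimum over the indices from [k] on is at most its term at [k + K], where the Cauchy bound
   applies. *)
apply: nearW => k; apply: (@le_trans _ _
    (\int[P]_x ((u n x - v (k + K)%N x) ^+ 2)%:E)%E).
  by apply: ereal_inf_lbound; exists (k + K)%N => //=; rewrite leq_addr.
by apply: KP => //; apply: leq_trans (leq_addr _ _); exact: leq_addl.
Qed.

End RieszFischer.

#[local] Arguments inner : simpl never.
#[local] Arguments cintegral : simpl never.

Local Ltac circ_ring :=
  apply/funext => ?;
  rewrite /fadd /fsub /fscale /fmul /fconj /fzero;
  rewrite ?(conjcM, conjcD, conjcB, conjcX, conjcK, conjc0, conjc1);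
  try ring.

(** * Inner product, Cauchy-Schwarz inequality and completeness of complex L2 *)

Section Inner.
Context {R : realType}.
Notation mu := (circm R).
Implicit Types f g h : circ R.

Definition nsq f : R := Re (inner f f).

Lemma inner_cint f g : L2 f -> L2 g -> cint (fmul f (fconj g)).
Proof. by move=> f2 g2; apply: L2M_cint => //; exact: L2J. Qed.

Lemma innerDl f g h : L2 f -> L2 g -> L2 h ->
  inner (fadd f g) h = inner f h + inner g h.
Proof.
move=> *; rewrite /inner -cintegralD; [|exact: inner_cint..].
by congr cintegral; circ_ring.
Qed.

Lemma innerZl c f h : L2 f -> L2 h -> inner (fscale c f) h = c * inner f h.
Proof.
move=> *; rewrite /inner -cintegralZ; last exact: inner_cint.
by congr cintegral; circ_ring.
Qed.

Lemma innerC f g : L2 f -> L2 g -> inner g f = (inner f g)^*%C.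
Proof.
move=> *; rewrite /inner -cintegralJ; last exact: inner_cint.
by congr cintegral; circ_ring.
Qed.

Lemma innerDr f g h : L2 f -> L2 g -> L2 h ->
  inner h (fadd f g) = inner h f + inner h g.
Proof.
move=> f2 g2 h2; rewrite (innerC (L2D f2 g2) h2) innerDl// conjcD.
by rewrite -!innerC.
Qed.

Lemma innerZr c f h : L2 f -> L2 h -> inner h (fscale c f) = c^*%C * inner h f.
Proof.
move=> f2 h2; rewrite (innerC (L2Z c f2) h2) innerZl// conjcM.
by rewrite -innerC.
Qed.

Lemma innerBl f g h : L2 f -> L2 g -> L2 h ->
  inner (fsub f g) h = inner f h - inner g h.
Proof.
by move=> f2 g2 h2; rewrite fsubE innerDl ?innerZl ?mulN1r//; exact: L2Z.
Qed.

Lemma innerBr f g h : L2 f -> L2 g -> L2 h ->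
  inner h (fsub f g) = inner h f - inner h g.
Proof.
by move=> f2 g2 h2; rewrite (innerC (L2B f2 g2) h2) innerBl// conjcB -!innerC.
Qed.

Lemma inner0l f : L2 f -> inner fzero f = 0.
Proof.
move=> f2; have -> : fzero = fscale 0 f by circ_ring.
by rewrite innerZl// mul0r.
Qed.

Lemma inner0r f : L2 f -> inner f fzero = 0.
Proof.
by move=> f2; rewrite (innerC (L2_fzero) f2) inner0l// conjc0.
Qed.

Lemma innerMl h f g : inner (fmul h f) g = inner f (fmul (fconj h) g).
Proof. by rewrite /inner; congr cintegral; circ_ring. Qed.

Lemma innerMr h f g : inner f (fmul h g) = inner (fmul (fconj h) f) g.
Proof. by rewrite /inner; congr cintegral; circ_ring. Qed.

Lemma innerJJ f g : L2 f -> L2 g -> inner (fconj f) (fconj g) = (inner f g)^*%C.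
Proof.
move=> f2 g2; rewrite -innerC// /inner; congr cintegral; circ_ring.
Qed.

Lemma inner_eqm f f' g g' : L2 f -> L2 f' -> L2 g -> L2 g' ->
  eqm f f' -> eqm g g' -> inner f g = inner f' g'.
Proof.
move=> f2 f'2 g2 g'2 /eqmP ff' /eqmP gg'; rewrite /inner.
apply: cintegral_eqm; do ?[by apply: cmeasM; [|apply: cmeasJ]; exact: L2_cmeas].
by apply/eqmP; apply: aeS2 ff' gg' => t; rewrite /fmul /fconj => -> ->.
Qed.

Lemma nsqE f : nsq f = Rintegral mu setT (fun t => cabs2 (f t)).
Proof.
rewrite /nsq /inner /=; apply: eq_Rintegral => t _.
by rewrite /fmul /fconj -cabs2E.
Qed.

Lemma nsq_ge0 f : 0 <= nsq f.
Proof. by rewrite nsqE; apply: Rintegral_ge0 => t _; exact: cabs2_ge0. Qed.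

Lemma inner_nsq f : L2 f -> inner f f = (nsq f)%:C.
Proof.
move=> f2; have := innerC f2 f2; rewrite /nsq.
case: (inner f f) => a b [] b0; congr (_ +i* _).
by move: b0 => /eqP; rewrite -addr_eq0 -mulr2n mulrn_eq0/= => /eqP.
Qed.

Lemma norm2E f : norm2 f = Num.sqrt (nsq f).
Proof. by []. Qed.

Lemma nsqZ c f : L2 f -> nsq (fscale c f) = cabs2 c * nsq f.
Proof.
move=> f2; apply: (@complexI R); rewrite -inner_nsq; last exact: L2Z.
rewrite innerZl ?innerZr//; last exact: L2Z.
by rewrite inner_nsq// mulrA -cabs2E -rmorphM.
Qed.

Lemma nsqD f g : L2 f -> L2 g ->
  nsq (fadd f g) = nsq f + nsq g + 2 * Re (inner f g).
Proof.
move=> f2 g2; have fg := L2D f2 g2; rewrite {1}/nsq innerDl// !innerDr//.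
rewrite (innerC f2 g2) !inner_nsq// !creD creJ /=; ring.
Qed.

Lemma nsqB f g : L2 f -> L2 g ->
  nsq (fsub f g) = nsq f + nsq g - 2 * Re (inner f g).
Proof.
move=> f2 g2; rewrite fsubE nsqD//; last exact: L2Z.
rewrite nsqZ// innerZr// creM /cabs2 /=; ring.
Qed.

Lemma nsqD_le f g : L2 f -> L2 g -> nsq (fadd f g) <= 2 * nsq f + 2 * nsq g.
Proof.
move=> f2 g2; have := nsq_ge0 (fsub f g); rewrite nsqD// nsqB//; lra.
Qed.

Lemma nsqBC f g : nsq (fsub f g) = nsq (fsub g f).
Proof.
by rewrite !nsqE; apply: eq_Rintegral => t _; rewrite /fsub -opprB cabs2N.
Qed.

Lemma nsq_triangle f g h : L2 f -> L2 g -> L2 h ->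
  nsq (fsub f h) <= 2 * nsq (fsub f g) + 2 * nsq (fsub g h).
Proof.
move=> f2 g2 h2.
have -> : fsub f h = fadd (fsub f g) (fsub g h) by circ_ring.
by apply: nsqD_le; exact: L2B.
Qed.

Lemma nsq_eqm f g : L2 f -> L2 g -> eqm f g -> nsq f = nsq g.
Proof. by move=> f2 g2 fg; rewrite /nsq (inner_eqm f2 g2 f2 g2). Qed.

(** The discriminant argument of the Cauchy-Schwarz inequality: there [A], [B], [W] are the squares
    of the norms of [f], [g] and of [<f, g>], and the quadratic is the squared norm of
    [f - t <f, g> g]. It is minimal at [t = 1 / B]; if [B = 0] it is affine, and a positive [W]
    would allow the value -1. Near minimizers use it again, with a small [A]. *)
Lemma quadratic_ge0 (A B W : R) : 0 <= A -> 0 <= B -> 0 <= W ->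
  (forall t : R, 0 <= A + t ^+ 2 * W * B - 2 * t * W) -> W <= A * B.
Proof.
move=> n0 m0 w0 H; have [g0|gn0] := eqVneq B 0.
  rewrite g0 mulr0 leNgt; apply/negP => wgt.
  have := H ((A + 1) / (2 * W)); rewrite g0 mulr0 addr0.
  have -> : 2 * ((A + 1) / (2 * W)) * W = A + 1 by field; rewrite gt_eqF.
  by rewrite opprD addrA subrr add0r oppr_ge0 leNgt ltr01.
have ggt : 0 < B by rewrite lt_neqAle eq_sym gn0.
have := H B^-1.
have -> : A + B^-1 ^+ 2 * W * B - 2 * B^-1 * W = A - W / B by field.
by rewrite subr_ge0 ler_pdivrMr.
Qed.

Lemma cauchy_schwarz f g : L2 f -> L2 g ->
  cabs2 (inner f g) <= nsq f * nsq g.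
Proof.
move=> f2 g2; set w := inner f g.
apply: quadratic_ge0; rewrite ?nsq_ge0 ?cabs2_ge0// => t.
have := nsq_ge0 (fsub f (fscale (t%:C * w) g)).
rewrite nsqB//; last exact: L2Z.
rewrite nsqZ// innerZr// -/w cabs2M cabs2R.
have -> : Re ((t%:C * w)^*%C * w) = t * cabs2 w.
  by rewrite conjcM conjc_real -mulrA [_ * w]mulrC -cabs2E creM/= mul0r subr0.
by rewrite mulrA.
Qed.

Lemma nsq_eq0 f : L2 f -> nsq f = 0 -> eqm f fzero.
Proof.
move=> f2; have /L2P[mf iff] := f2; rewrite nsqE /Rintegral => h.
have : (\int[mu]_t `|(cabs2 (f t))%:E| = 0)%E.
  under eq_integral do rewrite gee0_abs ?lee_fin ?cabs2_ge0//.
  have fin := integrable_fin_num measurableT iff.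
  exact: etrans (esym (fineK fin)) (congr1 EFin h).
move=> /(ae_eq_integral_abs mu measurableT) h'.
have {}h' := h' (proj2 (measurable_EFinP _ _) (cmeas_cabs2 mf)).
by apply/eqmP; apply: aeS h' => t /(_ I) [] /cabs2_eq0.
Qed.

Lemma inner_eq0 f : L2 f -> inner f f = 0 -> eqm f fzero.
Proof. by move=> f2 h; apply: nsq_eq0 => //; rewrite /nsq h. Qed.

Lemma integral_nsq f : L2 f -> (\int[mu]_t (cabs2 (f t))%:E = (nsq f)%:E)%E.
Proof.
move=> f2; have /L2P[mf iff] := f2; rewrite nsqE /Rintegral fineK//.
exact: (integrable_fin_num measurableT iff).
Qed.

Lemma L2_complete (u : nat -> circ R) : (forall n, L2 (u n)) ->
  (forall e : R, 0 < e -> exists N, forall m n, (N <= m)%N -> (N <= n)%N ->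
     nsq (fsub (u m) (u n)) <= e) ->
  exists2 f, L2 f & forall e : R, 0 < e -> exists N, forall n, (N <= n)%N ->
     nsq (fsub (u n) f) <= e.
Proof.
move=> u2 cu; have mu_ n := L2_cmeas (u2 n).
have le_part (a : measurableTypeR R -> R) f (e : R) : L2 f ->
    measurable_fun setT a -> (forall t, a t ^+ 2 <= cabs2 (f t)) ->
    nsq f <= e -> (\int[mu]_t (a t ^+ 2)%:E <= e%:E)%E.
  move=> f2 ma af fe; apply: (@le_trans _ _ (nsq f)%:E); last by rewrite lee_fin.
  rewrite -integral_nsq//; apply: ge0_le_integral => //.
  - by move=> t _; rewrite lee_fin sqr_ge0.
  - exact/measurable_EFinP/measurable_funX.
  - by apply/measurable_EFinP; exact: cmeas_cabs2 (L2_cmeas f2).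
  - by move=> t _; rewrite lee_fin.
have [a [ma ca]] : exists f : R -> R, measurable_fun [set: measurableTypeR R] f /\
    (forall e : R, 0 < e -> exists N, forall n, (N <= n)%N ->
     (\int[mu]_x ((Re (u n x) - f x) ^+ 2)%:E <= e%:E)%E).
  apply: (@riesz_fischer _ _ _ mu (fun n x => Re (u n x))) => [n|e e0].
    by case: (mu_ n).
  have [N NP] := cu e e0; exists N => m n Nm Nn.
  apply: (le_part _ _ _ (L2B (u2 m) (u2 n))); last exact: NP.
    by apply: measurable_funB; [case: (mu_ m)|case: (mu_ n)].
  by move=> t; rewrite /cabs2 /fsub creD creN lerDl sqr_ge0.
have [b [mb cb]] : exists f : R -> R, measurable_fun [set: measurableTypeR R] f /\
    (forall e : R, 0 < e -> exists N, forall n, (N <= n)%N ->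
     (\int[mu]_x ((Im (u n x) - f x) ^+ 2)%:E <= e%:E)%E).
  apply: (@riesz_fischer _ _ _ mu (fun n x => Im (u n x))) => [n|e e0].
    by case: (mu_ n).
  have [N NP] := cu e e0; exists N => m n Nm Nn.
  apply: (le_part _ _ _ (L2B (u2 m) (u2 n))); last exact: NP.
    by apply: measurable_funB; [case: (mu_ m)|case: (mu_ n)].
  by move=> t; rewrite /cabs2 /fsub cimD cimN lerDr sqr_ge0.
pose f : circ R := fun t => a t +i* b t.
have mf : cmeas f by [].
have main e : 0 < e -> exists N, forall n, (N <= n)%N ->
    (\int[mu]_t (cabs2 (fsub (u n) f t))%:E <= e%:E)%E.
  move=> e0; have e20 : 0 < e / 2 by rewrite divr_gt0.
  have [N1 N1P] := ca _ e20; have [N2 N2P] := cb _ e20.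
  exists (maxn N1 N2) => n; rewrite geq_max => /andP[n1 n2].
  have -> : (\int[mu]_t (cabs2 (fsub (u n) f t))%:E =
     \int[mu]_t (((Re (u n t) - a t) ^+ 2)%:E + ((Im (u n t) - b t) ^+ 2)%:E))%E.
    by apply: eq_integral => t _; rewrite /cabs2 /fsub creD cimD creN cimN.
  have [mr mi] := mu_ n.
  rewrite ge0_integralD//; do ?[by move=> t _; rewrite lee_fin sqr_ge0
    | exact/measurable_EFinP/measurable_funX/measurable_funB].
  by rewrite [e]splitr EFinD leeD// ?N1P ?N2P.
have uf n N : (N <= n)%N -> (\int[mu]_t (cabs2 (fsub (u n) f t))%:E <= N%:R%:E)%E ->
    L2 (fsub (u n) f).
  move=> _ h; apply/L2P; split; first exact: cmeasB.
  apply/integrableP; split; first by apply/measurable_EFinP; exact: cmeas_cabs2 (cmeasB (mu_ n) mf).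
  under eq_integral do rewrite /= ger0_norm ?cabs2_ge0//.
  by apply: le_lt_trans h _; rewrite ltry.
have f2 : L2 f.
  have [N NP] := main 1 ltr01.
  have -> : f = fsub (u N.+1) (fsub (u N.+1) f) by circ_ring.
  apply: L2B => //; apply: (uf _ 1%N) => //; exact: NP.
exists f => // e e0; have [N NP] := main e e0; exists N => n Nn.
by rewrite -lee_fin -integral_nsq; [exact: NP | exact: L2B].
Qed.

End Inner.

(** * Closed subspaces and projections *)

Section Hilbert.
Context {R : realType}.
Notation mu := (circm R).
Implicit Types (f g h : circ R) (S D K : set (circ R)).

Lemma le0_eps (x C : R) : (forall e, 0 < e -> x <= C * e) -> x <= 0.
Proof.
move=> H; apply/ler_addgt0Pl => e e0; rewrite addr0.
have c0 : 0 < `|C| + 1 by rewrite ltr_wpDl.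
apply: le_trans (H _ (divr_gt0 e0 c0)) _.
rewrite mulrA ler_pdivrMr// mulrC ler_pM2l//.
by apply: le_trans (ler_norm _) _; rewrite lerDl.
Qed.

Definition linear_subspace S :=
  S fzero /\ forall c f g, S f -> S g -> S (fadd (fscale c f) g).

Definition dense_in D S :=
  forall f e, S f -> 0 < e -> exists2 d, D d & nsq (fsub f d) <= e.

(** Elements are functions, so the last clause also makes [S] stable under a.e. equality: functions
    equal a.e. are at distance 0. *)
Definition closed_subspace S := [/\ S `<=` L2, linear_subspace S &
  forall f, L2 f -> (forall e, 0 < e -> exists2 s, S s & nsq (fsub f s) <= e) -> S f].

Section Subspace.
Variables (S : set (circ R)) (lS : linear_subspace S).

Lemma subspaceD f g : S f -> S g -> S (fadd f g).
Proof.
move=> Sf Sg; have -> : fadd f g = fadd (fscale 1 f) g by circ_ring.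
exact: lS.2.
Qed.

Lemma subspaceZ c f : S f -> S (fscale c f).
Proof.
move=> Sf; have -> : fscale c f = fadd (fscale c f) fzero by circ_ring.
by apply: lS.2 => //; exact: lS.1.
Qed.

Lemma subspaceB f g : S f -> S g -> S (fsub f g).
Proof. by move=> Sf Sg; rewrite fsubE; apply: subspaceD => //; exact: subspaceZ. Qed.

End Subspace.

Lemma invS_small (e : R) : 0 < e ->
  exists N, forall n, (N <= n)%N -> n.+1%:R^-1 <= e.
Proof.
move=> e0; exists (Num.truncn e^-1) => n Nn.
rewrite invf_ple ?posrE ?ltr0n//; apply: ltW; apply: lt_le_trans (truncnS_gt _) _.
  by rewrite ler_nat ltnS.
Qed.

(** Moving [s] by a multiple of [h] cannot bring it closer to [f] than [d], so the residue is
    orthogonal to [h] up to an error of order [eps]. This quantitative form passes to the limit of a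
    minimizing sequence. *)
Lemma near_minimizer S f (d eps : R) s h : S `<=` L2 -> linear_subspace S ->
  L2 f -> (forall s, S s -> d <= nsq (fsub f s)) ->
  S s -> nsq (fsub f s) <= d + eps -> 0 <= eps -> S h ->
  cabs2 (inner (fsub f s) h) <= eps * nsq h.
Proof.
move=> S2 lS f2 dmin Ss seps eps0 Sh; set w := inner _ _.
have fs2 : L2 (fsub f s) by apply: L2B => //; exact: S2.
have h2 := S2 _ Sh.
apply: quadratic_ge0; rewrite ?nsq_ge0 ?cabs2_ge0// => t.
have Ssh : S (fadd s (fscale (t%:C * w) h)).
  by apply: subspaceD => //; exact: subspaceZ.
have := dmin _ Ssh.
have -> : fsub f (fadd s (fscale (t%:C * w) h)) =
  fsub (fsub f s) (fscale (t%:C * w) h) by circ_ring.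
rewrite nsqB//; last exact: L2Z.
rewrite nsqZ// innerZr// -/w cabs2M cabs2R.
have -> : Re ((t%:C * w)^*%C * w) = t * cabs2 w.
  by rewrite conjcM conjc_real -mulrA [_ * w]mulrC -cabs2E creM/= mul0r subr0.
by move: seps; set a := nsq _; set b := nsq h; set c := cabs2 w => *; lra.
Qed.

Lemma orthogonal_projection S f : closed_subspace S -> L2 f ->
  exists2 g, S g & forall h, S h -> inner (fsub f g) h = 0.
Proof.
move=> [S2 lS clS] f2.
pose E := [set nsq (fsub f s) | s in S].
have E0 : E !=set0 by exists (nsq (fsub f fzero)); exists fzero => //; exact: lS.1.
have Elb : has_lbound E by exists 0 => _ [s _ <-]; exact: nsq_ge0.
have hE : has_inf E by split.
pose d := inf E.
have dmin s : S s -> d <= nsq (fsub f s).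
  by move=> Ss; apply: ge_inf => //; exists s.
have ex n : exists s, S s /\ nsq (fsub f s) <= d + n.+1%:R^-1.
  have n0 : (0 : R) < n.+1%:R^-1 by rewrite invr_gt0 ltr0n.
  by have [_ [s Ss <-] /ltW] := inf_adherent n0 hE; exists s.
have [s sP] := choice ex.
have Ss n : S (s n) by case: (sP n).
have sd n : nsq (fsub f (s n)) <= d + n.+1%:R^-1 by case: (sP n).
have s2 n := S2 _ (Ss n).
have fs2 n : L2 (fsub f (s n)) by exact: L2B.
(* Parallelogram law: the squared distance is twice the sum of the two squared residues minus 4
   times that of the midpoint, and the midpoint lies in [S], so its residue is at least [d]. *)
have cs m n : nsq (fsub (s m) (s n)) <= 2 * m.+1%:R^-1 + 2 * n.+1%:R^-1.
  have -> : fsub (s m) (s n) = fsub (fsub f (s n)) (fsub f (s m)) by circ_ring.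
  have := nsqD (fs2 n) (fs2 m); have := nsqB (fs2 n) (fs2 m).
  have Smid : S (fscale (2^-1)%:C (fadd (s m) (s n))).
    by apply: subspaceZ => //; exact: subspaceD.
  have mid2 : L2 (fsub f (fscale (2^-1)%:C (fadd (s m) (s n)))).
    by apply: L2B => //; exact: S2.
  have := dmin _ Smid.
  have -> : fadd (fsub f (s n)) (fsub f (s m)) =
      fscale (2%:R : R)%:C (fsub f (fscale (2^-1)%:C (fadd (s m) (s n)))).
    apply/funext => t; rewrite /fadd /fsub /fscale mulrBr mulrA -rmorphM.
    by rewrite divff ?pnatr_eq0// rmorph1 rmorph_nat; ring.
  rewrite nsqZ// cabs2R; move: (sd m) (sd n).
  set A := nsq (fsub f (s n)); set B := nsq (fsub f (s m)).
  set N := nsq (fsub f _); set r := Re _; set N' := nsq _.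
  set x := (m.+1)%:R^-1; set y := (n.+1)%:R^-1.
  lra.
have [g g2 gs] : exists2 g, L2 g & forall e : R, 0 < e -> exists N, forall n,
    (N <= n)%N -> nsq (fsub (s n) g) <= e.
  apply: L2_complete => // e e0.
  have [N NP] := invS_small (divr_gt0 e0 (ltr0n _ 4)).
  exists N => m n Nm Nn; apply: le_trans (cs m n) _.
  move: (NP _ Nm) (NP _ Nn); set x := (m.+1)%:R^-1; set y := (n.+1)%:R^-1.
  by lra.
have Sg : S g.
  apply: clS => // e e0; have [N NP] := gs e e0; exists (s N) => //.
  by rewrite nsqBC; exact: NP.
exists g => // h Sh; have h2 := S2 _ Sh.
apply: cabs2_eq0; apply/eqP; rewrite eq_le cabs2_ge0 andbT.
(* Both parts of [f - g], through [s n], contribute at most [e * nsq h], and [cabs2D_le] doubles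
   each. *)
apply: (@le0_eps _ (4 * nsq h)) => e e0.
have [N NP] := invS_small e0; have [N' N'P] := gs e e0.
pose n := maxn N N'.
have -> : fsub f g = fadd (fsub f (s n)) (fsub (s n) g) by circ_ring.
rewrite innerDl//; last exact: L2B.
apply: le_trans (cabs2D_le _ _) _.
have n0 : (0 : R) <= n.+1%:R^-1 by rewrite invr_ge0 ler0n.
have h1 := near_minimizer S2 lS f2 dmin (Ss n) (sd n) n0 Sh.
have h3 := cauchy_schwarz (L2B (s2 n) g2) h2.
have h4 := N'P n (leq_maxr _ _); have h5 := NP n (leq_maxl _ _).
have hh := nsq_ge0 h.
have : cabs2 (inner (fsub f (s n)) h) <= e * nsq h.
  by apply: le_trans h1 _; rewrite ler_wpM2r.
have : cabs2 (inner (fsub (s n) g) h) <= e * nsq h.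
  by apply: le_trans h3 _; rewrite ler_wpM2r.
lra.
Qed.

Lemma closure_closed_subspace D : D `<=` L2 -> linear_subspace D ->
  closed_subspace [set f | L2 f /\
    forall e, 0 < e -> exists2 d, D d & nsq (fsub f d) <= e].
Proof.
move=> D2 lD; split; first by move=> f [].
  split.
    split; first exact: L2_fzero.
    move=> e e0; exists fzero; first exact: lD.1.
    have -> : fsub fzero fzero = fzero :> circ R by circ_ring.
    by rewrite /nsq inner0l ?ltW//; exact: L2_fzero.
  move=> c f g [f2 fD] [g2 gD]; split; first by apply: L2D => //; exact: L2Z.
  (* With both errors at most [e / (2 * cabs2 c + 2)], the estimate of [nsqD_le] adds up to exactly
     [e]; the denominator is positive even for [c = 0]. *)
  move=> e e0; have k0 : 0 < 2 * cabs2 c + 2 by have := cabs2_ge0 c; lra.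
  have [d Dd df] := fD _ (divr_gt0 e0 k0); have [d' Dd' d'g] := gD _ (divr_gt0 e0 k0).
  exists (fadd (fscale c d) d'); first exact: lD.2.
  have -> : fsub (fadd (fscale c f) g) (fadd (fscale c d) d') =
    fadd (fscale c (fsub f d)) (fsub g d') by circ_ring.
  have d2 := D2 _ Dd; have d'2 := D2 _ Dd'.
  have a2 := L2B f2 d2; have b2 := L2B g2 d'2.
  apply: le_trans (nsqD_le (L2Z c a2) b2) _; rewrite nsqZ//.
  have -> : e = 2 * (cabs2 c * (e / (2 * cabs2 c + 2))) + 2 * (e / (2 * cabs2 c + 2)).
    by field; rewrite gt_eqF//; have := cabs2_ge0 c; lra.
  by rewrite lerD// ler_pM2l// ler_wpM2l// cabs2_ge0.
move=> f f2 fD; split => // e e0.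
have [s [s2 sD] sf] := fD _ (divr_gt0 e0 (ltr0n _ 4)).
have [d Dd ds] := sD _ (divr_gt0 e0 (ltr0n _ 4)).
exists d => //; apply: le_trans (nsq_triangle f2 s2 (D2 _ Dd)) _.
by move: sf ds; lra.
Qed.

(** After projection on the closure of [D], the residue of [f] is still in [S] and is orthogonal to
    [D]; so it vanishes and [f] lies in the closure. *)
Lemma dense_of_orthogonal S D : closed_subspace S -> D `<=` S ->
  linear_subspace D ->
  (forall f, S f -> (forall d, D d -> inner f d = 0) -> eqm f fzero) ->
  dense_in D S.
Proof.
move=> [S2 lS clS] DS lD H f e Sf e0; have f2 := S2 _ Sf.
have D2 : D `<=` L2 by move=> d /DS/S2.
have [g [g2 gD] gort] := orthogonal_projection (closure_closed_subspace D2 lD) f2.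
have Sg : S g.
  by apply: clS => // e' e'0; have [d Dd ?] := gD _ e'0; exists d => //; exact: DS.
have fg0 : nsq (fsub f g) = 0.
  rewrite (@nsq_eqm _ _ fzero) ?/nsq ?inner0l//; first exact: L2_fzero.
  - exact: L2B.
  - exact: L2_fzero.
  apply: H; first exact: subspaceB.
  move=> d Dd; apply: gort; split; first exact: D2.
  move=> e' e'0; exists d => //.
  have -> : fsub d d = fzero :> circ R by circ_ring.
  by rewrite /nsq inner0l ?ltW//; exact: L2_fzero.
have [d Dd dg] := gD _ (divr_gt0 e0 (ltr0n _ 2)); exists d => //.
apply: le_trans (nsq_triangle f2 g2 (D2 _ Dd)) _; rewrite fg0.
by move: dg; lra.
Qed.

(** Continuity of [l] and its vanishing on [D] enter together, as a bound of [l f] by the distance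
    from [f] to points of [D]. *)
Lemma dense_vanish S D (l : circ R -> R[i]) (M : R) :
  dense_in D S ->
  (forall f d, S f -> D d -> cabs2 (l f) <= M * nsq (fsub f d)) ->
  forall f, S f -> l f = 0.
Proof.
move=> dD H f Sf; apply: cabs2_eq0; apply/eqP; rewrite eq_le cabs2_ge0 andbT.
have M0 : 0 <= `|M| by [].
apply: (@le0_eps _ `|M|) => e e0; have [d Dd dg] := dD _ _ Sf e0.
apply: le_trans (H _ _ Sf Dd) _.
apply: (@le_trans _ _ (`|M| * nsq (fsub f d))).
  by rewrite ler_wpM2r ?nsq_ge0// ler_norm.
by rewrite ler_wpM2l.
Qed.

Lemma bounded_onP D (X : op R) : bounded_on D X <->
  exists2 M : R, 0 <= M & forall f, D f -> nsq (X f) <= M * nsq f.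
Proof.
split=> [[M HM]|[M M0 HM]].
  exists (M ^+ 2); first exact: sqr_ge0.
  move=> f Df; have := HM f Df; rewrite !norm2E => h.
  rewrite -[nsq (X f)]sqr_sqrtr ?nsq_ge0// -[nsq f in leRHS]sqr_sqrtr ?nsq_ge0//.
  by rewrite -exprMn lerXn2r// ?nnegrE ?sqrtr_ge0//; apply: le_trans h; exact: sqrtr_ge0.
exists (Num.sqrt M) => f Df; rewrite !norm2E -sqrtrM//.
by rewrite ler_sqrt ?HM// mulr_ge0// nsq_ge0.
Qed.

(** The arguments are extended one at a time: [step] is used first with its fixed element in [D],
    then, with the roles of the arguments exchanged, for any element of [S]. *)
Lemma symmetric_extension S D (X : op R) : closed_subspace S -> D `<=` S ->
  dense_in D S -> antilinear_on S S X -> bounded_on S X ->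
  (forall f g, D f -> D g -> inner (X f) g = inner (X g) f) ->
  forall f g, S f -> S g -> inner (X f) g = inner (X g) f.
Proof.
move=> [S2 lS _] DS dD [XS Xl] /bounded_onP[M M0 XM] symD.
have XB f g : S f -> S g -> eqm (X (fsub f g)) (fsub (X f) (X g)).
  move=> Sf Sg; have := Xl (-1) g f Sg Sf.
  have -> : fadd (fscale (-1) g) f = fsub f g by circ_ring.
  suff -> : fadd (fscale (-1)^*%C (X g)) (X f) = fsub (X f) (X g) by [].
  by apply/funext => t; rewrite /fadd /fscale /fsub rmorphN rmorph1 mulN1r addrC.
have step g : S g -> (forall d, D d -> inner (X d) g = inner (X g) d) ->
    forall f, S f -> inner (X f) g = inner (X g) f.
  move=> Sg Hg f Sf; apply/eqP; rewrite -subr_eq0; apply/eqP.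
  pose l f := inner (X f) g - inner (X g) f.
  have g2 := S2 _ Sg; have Xg2 := S2 _ (XS _ Sg).
  apply: (@dense_vanish S D l (2 * M * nsq g + 2 * nsq (X g))) => // {Sf}f d Sf Dd.
  have f2 := S2 _ Sf; have d2 := S2 _ (DS _ Dd).
  have Sfd : S (fsub f d) by apply: subspaceB => //; exact: DS.
  have Xf2 := S2 _ (XS _ Sf); have Xd2 := S2 _ (XS _ (DS _ Dd)).
  have Xfd2 := S2 _ (XS _ Sfd).
  have -> : l f = inner (X (fsub f d)) g + - inner (X g) (fsub f d).
    rewrite (inner_eqm Xfd2 (L2B Xf2 Xd2) g2 g2 (XB _ _ Sf (DS _ Dd)) (eqm_refl _)).
    rewrite innerBl// innerBr// (Hg d Dd) /l; ring.
  apply: le_trans (cabs2D_le _ _) _.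
  have -> : cabs2 (- inner (X g) (fsub f d)) = cabs2 (inner (X g) (fsub f d)).
    by rewrite /cabs2 creN cimN !sqrrN.
  have h1 := cauchy_schwarz Xfd2 g2.
  have h2 := cauchy_schwarz Xg2 (S2 _ Sfd).
  have h3 := XM _ Sfd.
  have : nsq (X (fsub f d)) * nsq g <= M * nsq (fsub f d) * nsq g.
    by rewrite ler_wpM2r// nsq_ge0.
  move: h1 h2; lra.
move=> f g Sf Sg.
apply: (step g) => // d Dd; symmetry; apply: (step d) => //; first exact: DS.
by move=> d' Dd'; exact: symD.
Qed.

End Hilbert.

(** * Bounded extension from a dense subspace *)

Section Extension.
Context {R : realType}.
Notation mu := (circm R).
Implicit Types (f g h : circ R) (S D K : set (circ R)).

(** The extension is read off from [G], the closure of the graph of [T]. Completeness gives it a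
    value at each point of [S]; the value is unique a.e. because a difference of two values is a
    value at 0, which [Gbnd] forces to vanish. *)
Lemma bounded_extension S K D (T : op R) :
  closed_subspace S -> closed_subspace K -> D `<=` S -> linear_subspace D ->
  dense_in D S -> linear_on D K T -> bounded_on D T ->
  exists A : op R, [/\ linear_on S K A, bounded_on S A & op_eq D A T].
Proof.
move=> [S2 lS _] [K2 lK clK] DS lD dD [TK Tl] /bounded_onP[M M0 TM].
have D2 : D `<=` L2 by move=> d /DS/S2.
have TB f g : D f -> D g -> nsq (fsub (T f) (T g)) <= M * nsq (fsub f g).
  move=> Df Dg; have := TM _ (subspaceB lD Df Dg).
  have -> // : nsq (T (fsub f g)) = nsq (fsub (T f) (T g)).
  apply: nsq_eqm; first by apply: K2; apply: TK; exact: subspaceB.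
    by apply: L2B; apply: K2; exact: TK.
  have := Tl (-1) g f Dg Df.
  have -> : fadd (fscale (-1) g) f = fsub f g by circ_ring.
  suff -> : fadd (fscale (-1) (T g)) (T f) = fsub (T f) (T g) by [].
  by circ_ring.
pose G f g := K g /\ forall e, 0 < e ->
  exists d, [/\ D d, nsq (fsub f d) <= e & nsq (fsub g (T d)) <= e].
(* The factor 4 comes from two uses of [nsqD_le], one splitting [g] at [T d] and one splitting [d]
   at [f]; any finite constant serves. *)
have Gbnd f g : S f -> G f g -> nsq g <= 4 * M * nsq f.
  move=> Sf [Kg fg]; have f2 := S2 _ Sf; have g2 := K2 _ Kg.
  rewrite -subr_le0; apply: (@le0_eps _ _ (2 + 4 * M)) => e e0.
  have [d [Dd df dg]] := fg e e0.
  have d2 := D2 _ Dd; have Td2 := K2 _ (TK _ Dd).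
  have h1 : nsq g <= 2 * nsq (fsub g (T d)) + 2 * nsq (T d).
    have {1}-> : g = fadd (fsub g (T d)) (T d) by circ_ring.
    by apply: nsqD_le => //; exact: L2B.
  have h2 : nsq d <= 2 * nsq f + 2 * nsq (fsub f d).
    have {1}-> : d = fsub f (fsub f d) by circ_ring.
    rewrite fsubE; apply: le_trans (nsqD_le f2 (L2Z _ (L2B f2 d2))) _.
    rewrite nsqZ; last exact: L2B.
    have -> : cabs2 (-1 : R[i]) = 1 by rewrite /cabs2 /= oppr0 expr0n addr0 sqrrN expr1n.
    by rewrite mul1r.
  have h3 := TM _ Dd.
  have h4 : M * nsq d <= M * (2 * nsq f + 2 * e).
    by rewrite ler_wpM2l//; apply: le_trans h2 _; rewrite lerD2l ler_pM2l.
  move: h1 h3 h4 dg; nra.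
have Glin c f g f' g' : S f -> S f' -> G f g -> G f' g' ->
    G (fadd (fscale c f) f') (fadd (fscale c g) g').
  move=> Sf Sf' [Kg fg] [Kg' fg']; split; first exact: lK.2.
  move=> e e0; have k0 : 0 < 2 * cabs2 c + 2 by have := cabs2_ge0 c; lra.
  have [d [Dd df dg]] := fg _ (divr_gt0 e0 k0).
  have [d' [Dd' df' dg']] := fg' _ (divr_gt0 e0 k0).
  have d2 := D2 _ Dd; have d'2 := D2 _ Dd'.
  have f2 := S2 _ Sf; have f'2 := S2 _ Sf'; have g2 := K2 _ Kg; have g'2 := K2 _ Kg'.
  have Td2 := K2 _ (TK _ Dd); have Td'2 := K2 _ (TK _ Dd').
  have est u v : L2 u -> L2 v -> nsq u <= e / (2 * cabs2 c + 2) ->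
      nsq v <= e / (2 * cabs2 c + 2) -> nsq (fadd (fscale c u) v) <= e.
    move=> u2 v2 hu hv; apply: le_trans (nsqD_le (L2Z c u2) v2) _; rewrite nsqZ//.
    have -> : e = 2 * (cabs2 c * (e / (2 * cabs2 c + 2))) + 2 * (e / (2 * cabs2 c + 2)).
      by field; rewrite gt_eqF.
    by rewrite lerD// ler_pM2l// ler_wpM2l// cabs2_ge0.
  exists (fadd (fscale c d) d'); split; first exact: lD.2.
    have -> : fsub (fadd (fscale c f) f') (fadd (fscale c d) d') =
      fadd (fscale c (fsub f d)) (fsub f' d') by circ_ring.
    by apply: est => //; exact: L2B.
  rewrite (@nsq_eqm _ _ (fadd (fscale c (fsub g (T d))) (fsub g' (T d')))).
  - by apply: est => //; exact: L2B.
  - apply: L2B; first by apply: L2D => //; exact: L2Z.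
    by apply: K2; apply: TK; exact: lD.2.
  - by apply: L2D; [apply: L2Z|]; exact: L2B.
  - apply/eqmP; apply: aeS (proj1 (eqmP _ _) (Tl c d d' Dd Dd')) => t.
    by rewrite /fsub => ->; rewrite /fadd /fscale; ring.
have Gex f : S f -> exists g, G f g.
  move=> Sf; have f2 := S2 _ Sf.
  have ex n : exists d, D d /\ nsq (fsub f d) <= n.+1%:R^-1.
    have n0 : (0 : R) < n.+1%:R^-1 by rewrite invr_gt0 ltr0n.
    by have [d Dd fd] := dD _ _ Sf n0; exists d.
  have [d dP] := choice ex.
  have Dd n : D (d n) by case: (dP n).
  have fd n : nsq (fsub f (d n)) <= n.+1%:R^-1 by case: (dP n).
  have d2 n := D2 _ (Dd n); have Td2 n := K2 _ (TK _ (Dd n)).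
  have cs m n : nsq (fsub (T (d m)) (T (d n))) <= M * (2 * m.+1%:R^-1 + 2 * n.+1%:R^-1).
    apply: le_trans (TB _ _ (Dd m) (Dd n)) _; rewrite ler_wpM2l//.
    apply: le_trans (nsq_triangle (d2 m) f2 (d2 n)) _.
    by rewrite (nsqBC (d m)) lerD// ler_pM2l.
  have [g g2 gs] : exists2 g, L2 g & forall e : R, 0 < e -> exists N, forall n,
      (N <= n)%N -> nsq (fsub (T (d n)) g) <= e.
    apply: L2_complete => // e e0.
    have k0 : 0 < 4 * M + 1 by lra.
    have [N NP] := invS_small (divr_gt0 e0 k0).
    exists N => m n Nm Nn; apply: le_trans (cs m n) _.
    apply: (@le_trans _ _ (M * (2 * (e / (4 * M + 1)) + 2 * (e / (4 * M + 1))))).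
      by rewrite ler_wpM2l// lerD// ler_pM2l// NP.
    have -> : M * (2 * (e / (4 * M + 1)) + 2 * (e / (4 * M + 1))) =
       e * (4 * M / (4 * M + 1)) by field; rewrite gt_eqF.
    rewrite ler_piMr ?(ltW e0)// ler_pdivrMr// mul1r; lra.
  exists g; split.
    apply: clK => // e e0; have [N NP] := gs e e0; exists (T (d N)); first exact: TK.
    by rewrite nsqBC; exact: NP.
  move=> e e0; have [N NP] := gs e e0; have [N' N'P] := invS_small e0.
  exists (d (maxn N N')); split => //.
    by apply: le_trans (fd _) _; apply: N'P; exact: leq_maxr.
  by rewrite nsqBC; apply: NP; exact: leq_maxl.
have Guniq f g g' : S f -> G f g -> G f g' -> eqm g g'.
  move=> Sf Gg Gg'; have [[Kg _] [Kg' _]] := (Gg, Gg').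
  have := Glin (-1) f g' f g Sf Sf Gg' Gg.
  have -> : fadd (fscale (-1) f) f = fzero by circ_ring.
  have -> : fadd (fscale (-1) g') g = fsub g g' by circ_ring.
  move=> /(Gbnd _ _ lS.1); rewrite {2}/nsq inner0l ?mulr0; last exact: L2_fzero.
  move=> n0; have : nsq (fsub g g') = 0 by apply/eqP; rewrite eq_le n0 nsq_ge0.
  move=> /nsq_eq0 h; have /eqmP {}h := h (L2B (K2 _ Kg) (K2 _ Kg')).
  by apply/eqmP; apply: aeS h => t /eqP; rewrite subr_eq0 => /eqP.
pose A : op R := fun f => xget fzero (G f).
have AG f : S f -> G f (A f).
  by move=> Sf; have [g Gg] := Gex f Sf; exact: (xgetPex fzero (ex_intro _ g Gg)).
exists A; split.
- split; first by move=> f /AG[].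
  move=> c f g Sf Sg; apply: (Guniq (fadd (fscale c f) g)).
  + exact: lS.2.
  + by apply: AG; exact: lS.2.
  + by apply: Glin => //; exact: AG.
- apply/bounded_onP; exists (4 * M); first by rewrite mulr_ge0.
  by move=> f Sf; apply: Gbnd => //; exact: AG.
- move=> d Dd; apply: (Guniq d); [exact: DS|by apply: AG; exact: DS|].
  split; first exact: TK.
  move=> e e0; exists d; split => //.
  + have -> : fsub d d = fzero by circ_ring.
    by rewrite /nsq inner0l ?ltW//; exact: L2_fzero.
  + have -> : fsub (T d) (T d) = fzero by circ_ring.
    by rewrite /nsq inner0l ?ltW//; exact: L2_fzero.
Qed.

End Extension.

(** * Uniqueness of Fourier coefficients *)

Section Steps.
Context {R : realType}.
Implicit Types u c x y : R.

Lemma bernoulli_ineq y N : -1 <= y -> 1 + N%:R * y <= (1 + y) ^+ N.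
Proof.
move=> y1; elim: N => [|N IH]; first by rewrite mul0r addr0 expr0.
rewrite exprS; apply: (@le_trans _ _ ((1 + y) * (1 + N%:R * y))); last first.
  by rewrite ler_wpM2l// -lerBlDl sub0r.
rewrite -natr1; have := sqr_ge0 y; have := ler0n R N => n0 yy.
have := mulr_ge0 n0 yy; rewrite expr2; lra.
Qed.

(* By Bernoulli's inequality: with [N] about [c^-n], the product [N * u^n] tends
   to 0 if [u < c] and to infinity if [c < u]. *)
Lemma cvg_step_poly u c : 0 <= u <= 1 -> 0 < c < 1 -> u != c ->
  (1 - u ^+ n) ^+ Num.truncn (c ^- n) @[n --> \oo] --> ((u < c)%R%:R : R).
Proof.
move=> /andP[u0 u1] /andP[c0 c1]; rewrite neq_lt => /orP[uc|cu].
  rewrite uc -[X in _ --> X]/(1 : R).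
  apply: (@squeeze_cvgr _ _ _ _ (fun n => 1 - (u / c) ^+ n) (cst 1)).
  - apply: nearW => n; have un0 : 0 <= u ^+ n by rewrite exprn_ge0.
    have un1 : u ^+ n <= 1 by rewrite exprn_ile1.
    apply/andP; split; last by rewrite exprn_ile1// ?subr_ge0// gerBl.
    have := @bernoulli_ineq (- u ^+ n) (Num.truncn (c ^- n)).
    rewrite lerN2 => /(_ un1); apply: le_trans.
    rewrite mulrN lerD2l lerN2 expr_div_n mulrC ler_wpM2l//.
    by rewrite truncn_le invr_ge0 exprn_ge0// ltW.
  - rewrite -[X in _ --> X]subr0; apply: cvgB; first exact: cvg_cst.
    have /cvg_expr : `|u / c| < 1; last exact.
    rewrite ger0_norm ?divr_ge0 ?(ltW c0)//.
    by rewrite ltr_pdivrMr// mul1r.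
  - exact: cvg_cst.
have u0' : 0 < u by apply: lt_trans cu.
rewrite ltNge (ltW cu) -[X in _ --> X]/(0 : R).
apply: (@squeeze_cvgr _ _ _ _ (cst 0) (fun n => 2 * (c / u) ^+ n)).
- apply: nearW => n; have un0 : 0 <= u ^+ n by rewrite exprn_ge0.
  have un1 : u ^+ n <= 1 by rewrite exprn_ile1.
  have ungt : 0 < u ^+ n by rewrite exprn_gt0.
  have cn : 1 <= c ^- n by rewrite invf_ge1 ?exprn_gt0// exprn_ile1// ltW.
  set N := Num.truncn _.
  apply/andP; split; first by rewrite exprn_ge0// subr_ge0.
  have N1 : (1 <= N)%N by rewrite truncn_gt0.
  (* Truncation loses less than 1, and [N] is at least 1. *)
  have N2 : c ^- n <= 2 * N%:R.
    apply: le_trans (ltW (truncnS_gt _)) _; rewrite -/N -natr1.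
    by have : (1 : R) <= N%:R; [rewrite ler1n | lra].
  have h1 : 1 + N%:R * u ^+ n <= (1 + u ^+ n) ^+ N.
    by apply: bernoulli_ineq; apply: le_trans un0; rewrite lerN10.
  (* This product bound turns the lower bound of Bernoulli's inequality for [(1 + u ^+ n) ^+ N] into
     an upper bound for [(1 - u ^+ n) ^+ N]. *)
  have h2 : (1 - u ^+ n) ^+ N * (1 + u ^+ n) ^+ N <= 1.
    rewrite -exprMn exprn_ile1//; first by rewrite mulr_ge0 ?subr_ge0// addr_ge0.
    have := mulr_ge0 un0 un0; lra.
  have p0 : 0 < N%:R * u ^+ n by rewrite mulr_gt0// ltr0n.
  have p1 : 0 < (1 + u ^+ n) ^+ N by rewrite exprn_gt0// ltr_wpDr.
  apply: (@le_trans _ _ (N%:R * u ^+ n)^-1).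
    rewrite -[leRHS]mul1r ler_pdivlMr//; apply: le_trans h2.
    rewrite ler_wpM2l ?exprn_ge0 ?subr_ge0//; lra.
  rewrite expr_div_n invfM mulrA ler_wpM2r ?invr_ge0//.
  rewrite -[c ^+ n]invrK ler_pdivlMr; last by rewrite invr_gt0 exprn_gt0.
  by rewrite mulrC ler_pdivrMr ?ltr0n.
- exact: cvg_cst.
- rewrite -[X in _ --> X](mulr0 2); apply: cvgM; first exact: cvg_cst.
  have /cvg_expr : `|c / u| < 1; last exact.
    rewrite ger0_norm ?divr_ge0 ?(ltW c0)//.
  by rewrite ltr_pdivrMr// mul1r.
Qed.

(** The arc from 0 to [b] consists of the points at angular distance at most [b / 2] from its
    midpoint, and the cosine decreases with that distance. Where [t - b / 2] exceeds [pi], the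
    distance is measured the other way round. *)
Lemma arc_cos (b t : R) : 0 < b < 2 * pi -> 0 < t < 2 * pi ->
  (cos (t - b / 2) < cos (b / 2)) = (b < t).
Proof.
move=> /andP[b0 b2] /andP[t0 t2].
have bI : b / 2 \in `[0, pi] by rewrite in_itv/=; apply/andP; split; lra.
have [tb|bt] := leP t b.
  apply/negbTE; rewrite -(cos_norm (t - b / 2)).
  have tI : `|t - b / 2| \in `[0, pi].
    by rewrite in_itv/= normr_ge0/= ler_norml; lra.
  rewrite ltr_cos// -leNgt ler_norml; lra.
have [tp|pt] := leP (t - b / 2) pi.
  rewrite ltr_cos//; first lra.
  by rewrite in_itv/=; lra.
have -> : cos (t - b / 2) = cos (2 * pi - (t - b / 2)).
  have -> : 2 * pi = pi *+ 2 :> R by rewrite mulr_natl.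
  by rewrite (cosB (pi *+ 2)) cos2pi sin2pi mul1r mul0r addr0.
rewrite ltr_cos//; first lra.
by rewrite in_itv/=; lra.
Qed.

Lemma arc_cos_neq (b t : R) : 0 < b < 2 * pi -> 0 < t < 2 * pi -> t != b ->
  cos (t - b / 2) != cos (b / 2).
Proof.
move=> bI /[dup] tI /andP[t0 t2]; have /andP[b0 b2] := bI.
rewrite neq_lt => /orP[tb|bt]; last by rewrite lt_eqF// arc_cos.
rewrite gt_eqF// -(cos_norm (t - b / 2)) ltr_cos.
- by rewrite ltr_norml; lra.
- by rewrite in_itv/= normr_ge0/= ler_norml; apply/andP; split; lra.
- by rewrite in_itv/=; lra.
Qed.

End Steps.

(** * From the circle measure to Lebesgue measure *)

Section Transfer.
Context {R : realType}.
Notation mu := (circm R).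
Notation leb := (@lebesgue_measure R).
Notation I2pi := `[0%R : R, (2 * pi)%R]%classic.

Lemma ge0_circm_integral (f : measurableTypeR R -> \bar R) :
  measurable_fun setT f -> (forall x, 0 <= f x)%E ->
  (\int[mu]_x f x = (2 * pi)^-1%:E * \int[leb]_(x in I2pi) f x)%E.
Proof. by move=> mf f0; rewrite /circm integral_uniform// subr0. Qed.

Let c0 : (0 < (2 * pi)^-1 :> R).
Proof. by rewrite invr_gt0 two_pi_gt0. Qed.

Lemma circm_integrableP (f : measurableTypeR R -> \bar R) :
  measurable_fun setT f ->
  mu.-integrable setT f <-> leb.-integrable I2pi f.
Proof.
move=> mf.
have E : (\int[mu]_x `|f x| = (2 * pi)^-1%:E * \int[leb]_(x in I2pi) `|f x|)%E.
  by apply: ge0_circm_integral => //; exact: measurableT_comp.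
split=> /integrableP[m1 l1]; apply/integrableP; split => //.
- exact: measurable_funTS.
- move: l1; rewrite E => h; rewrite ltNge; apply/negP => h'; move: h.
  have -> : (\int[leb]_(x in I2pi) `|f x| = +oo)%E by apply/eqP; rewrite -leye_eq.
  by rewrite gt0_muley ?lte_fin.
- rewrite E; apply: lte_mul_pinfty => //; first by rewrite lee_fin ltW.
Qed.

Lemma circm_integral (f : measurableTypeR R -> \bar R) :
  mu.-integrable setT f ->
  (\int[mu]_x f x = (2 * pi)^-1%:E * \int[leb]_(x in I2pi) f x)%E.
Proof.
move=> if1; have mf := measurable_int _ if1.
have if2 := proj1 (circm_integrableP mf) if1.
rewrite integralE [in RHS]integralE !ge0_circm_integral//.
- rewrite [RHS]muleBr//; apply: fin_num_adde_defr.
  by apply: integrable_fin_num => //; exact: integrable_funepos.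
- exact: measurable_funeneg.
- exact: measurable_funepos.
Qed.

Lemma circm_Rintegral (f : measurableTypeR R -> R) :
  mu.-integrable setT (EFin \o f) ->
  Rintegral mu setT f = (2 * pi)^-1 * Rintegral leb I2pi f.
Proof.
move=> if1; have mf := measurable_int _ if1.
have if2 := proj1 (circm_integrableP mf) if1.
rewrite /Rintegral circm_integral// fineM//.
exact: (integrable_fin_num _ if2).
Qed.

(** The end points are Lebesgue null, and the complement of the closed interval is null for [circm].
    Arguments by differentiation or by arcs thus need only the open interval. *)
Lemma ae_circm (Q : R -> Prop) :
  {ae leb, forall t, t \in `]0, (2 * pi)[ -> Q t} ->
  {ae mu, forall t, Q t}.
Proof.
move=> [N [mN N0 subN]].
pose B : set R := (N `|` [set 0; 2 * pi])%classic.
have mB : measurable (B : set (measurableTypeR R)).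
  by apply: measurableU => //; apply: measurableU => //.
have leB0 : leb B = 0.
  rewrite null_set_setU//.
  - by apply: measurableU => //.
  - by apply: null_set_setU => //; exact: lebesgue_measure_set1.
have muB0 : mu B = 0.
  by have /null_content_dominatesP := dominates_uniform_prob (@two_pi_gt0 R); exact.
have muC0 : mu (~` I2pi) = 0.
  rewrite /circm /= /uniform_prob integral_uniform_pdf.
  by rewrite setICl integral_set0.
exists (B `|` ~` I2pi); split.
- by apply: measurableU => //; exact: measurableC.
- by rewrite null_set_setU//; exact: measurableC.
move=> t /= nQ.
have [tI|tI] := boolP (t \in `[0, 2 * pi]); last by right; apply/negP.
left; have [tO|tO] := boolP (t \in `]0, 2 * pi[).
  by left; apply: subN => /= h; apply: nQ; exact: h.
right; move: tI tO; rewrite !in_itv/= => /andP[h1 h2].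
rewrite !lt_neqAle h1 h2 !andbT eq_sym negb_and !negbK => /orP[/eqP->|/eqP->];
  by [left|right].
Qed.

End Transfer.

(** * The monomials [z^n] and their integrals *)

Section Monomials.
Context {R : realType}.
Notation mu := (circm R).
Notation leb := (@lebesgue_measure R).
Notation I2pi := `[0%R : R, (2 * pi)%R]%classic.

Lemma fexp_zvarE n t : fexp zvar n t = cos (n%:R * t) +i* sin (n%:R * t) :> R[i].
Proof.
elim: n => [|n IH]; first by rewrite /fexp expr0 mul0r cos0 sin0.
rewrite /fexp exprS -/(fexp zvar n t) IH /zvar -natr1 mulrDl mul1r cosD sinD.
by simpc; congr (_ +i* _); ring.
Qed.

Lemma zvarJ t : zvar t * (zvar t)^*%C = 1 :> R[i].
Proof. by rewrite -cabs2E /cabs2 /= cos2Dsin2. Qed.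

Lemma cmeas_zvar : cmeas (zvar : circ R).
Proof.
split; apply: continuous_measurable_fun; rewrite /zvar /=;
  [exact: continuous_cos|exact: continuous_sin].
Qed.

Lemma cmeas_fexp f n : cmeas f -> cmeas (fexp f n : circ R).
Proof.
move=> mf; elim: n => [|n IH]; first exact: cmeas_cst.
have -> : fexp f n.+1 = fmul f (fexp f n).
  by apply/funext => t; rewrite /fexp exprS.
exact: cmeasM.
Qed.

Lemma cabs2_zvar t : cabs2 (zvar t : R[i]) = 1.
Proof. by rewrite /cabs2 /= cos2Dsin2. Qed.

Lemma cabs2_fexp_zvar n t : cabs2 (fexp zvar n t : R[i]) = 1.
Proof. by rewrite fexp_zvarE /cabs2 /= cos2Dsin2. Qed.

Lemma L2_fexp n : L2 (fexp zvar n : circ R).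
Proof.
have -> : fexp zvar n = fmul (fexp zvar n) (fun=> 1) :> circ R.
  by apply/funext => t; rewrite /fmul mulr1.
apply: (@L2_bndM _ _ _ 1); last exact: L2_cst.
  exact/cmeas_fexp/cmeas_zvar.
by apply: aeW => t; rewrite cabs2_fexp_zvar.
Qed.

Lemma L2_zM f : L2 f -> L2 (fmul zvar f : circ R).
Proof.
apply: (@L2_bndM _ _ _ 1); first exact: cmeas_zvar.
by apply: aeW => t; rewrite cabs2_zvar.
Qed.

Lemma L2_zJM f : L2 f -> L2 (fmul (fconj zvar) f : circ R).
Proof.
apply: (@L2_bndM _ _ _ 1); first exact/cmeasJ/cmeas_zvar.
by apply: aeW => t; rewrite cabs2J cabs2_zvar.
Qed.

Let scaled_derive (k : R) (f df : R -> R) (x : R) : k != 0 ->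
  is_derive (k * x) 1 f (df (k * x)) ->
  is_derive x 1 (fun t => k^-1 * f (k * t)) (df (k * x)).
Proof.
move=> k0 dfx.
have h1 : is_derive x 1 (fun t : R => k * t) k.
  have : is_derive x 1 (k \*: (@id R)) (k *: 1) by exact: is_deriveZ.
  by rewrite /GRing.scale/= mulr1.
have h2 := @is_derive1_comp _ f (fun t => k * t) x _ _ dfx h1.
have : is_derive x 1 (k^-1 \*: (f \o (fun t => k * t))) (k^-1 *: (df (k * x) * k)).
  exact: is_deriveZ.
by rewrite /GRing.scale/= mulrCA mulVf// mulr1.
Qed.

Let integral_trig (k : R) (f df : R -> R) : k != 0 -> continuous df ->
  (forall x : R, is_derive x (1 : R) f (df x)) -> f 0 = f (k * (2 * pi)) ->
  Rintegral leb I2pi (fun t => df (k * t)) = 0.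
Proof.
move=> k0 cdf dfx per; rewrite /Rintegral.
have dF x := @scaled_derive k f df x k0 (dfx _).
rewrite (@continuous_FTC2 _ _ (fun t => k^-1 * f (k * t)) 0 (2 * pi)).
- by rewrite mulr0 -EFinB -mulrBr per subrr mulr0.
- exact: two_pi_gt0.
- apply: continuous_subspaceT => x; apply: continuous_comp; last exact: cdf.
  by apply: cvgM; [exact: cvg_cst|exact: cvg_id].
- have cF : continuous (fun t => k^-1 * f (k * t)).
    by move=> x; apply/differentiable_continuous/derivable1_diffP; have [] := dF x.
  split; first by move=> x _; have [] := dF x.
  + by apply: cvg_at_right_filter; exact: cF.
  + by apply: cvg_at_left_filter; exact: cF.
- by move=> x _; rewrite derive1E; have [_ ->] := dF x.
Qed.

Lemma cintegral_fexp n : cintegral (fexp zvar n.+1 : circ R) = 0.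
Proof.
have k0 : n.+1%:R != 0 :> R by rewrite pnatr_eq0.
have kpi : n.+1%:R * (2 * pi) = 0 + (pi *+ 2) *+ n.+1 :> R.
  by rewrite add0r -[RHS]mulr_natl -[pi *+ 2]mulr_natl.
have z2 := L2_fexp n.+1.
have [zr zi] : cint (fexp zvar n.+1 : circ R).
  have -> : fexp zvar n.+1 = fmul (fexp zvar n.+1) (fun=> 1) :> circ R.
    by apply/funext => t; rewrite /fmul mulr1.
  by apply: L2M_cint => //; exact: L2_cst.
rewrite /cintegral !circm_Rintegral//.
have -> : (fun t => Re (fexp zvar n.+1 t)) = (fun t : R => cos (n.+1%:R * t)).
  by apply/funext => t; rewrite fexp_zvarE.
have -> : (fun t => Im (fexp zvar n.+1 t)) = (fun t : R => sin (n.+1%:R * t)).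
  by apply/funext => t; rewrite fexp_zvarE.
have -> : Rintegral leb I2pi (fun t => cos (n.+1%:R * t)) = 0.
  apply: (@integral_trig _ sin cos) => //; first exact: continuous_cos.
  by rewrite kpi (periodicn (@sinD2pi R)).
have -> : Rintegral leb I2pi (fun t => sin (n.+1%:R * t)) = 0.
  apply: (@integral_trig _ (\- cos) sin) => //; first exact: continuous_sin.
    by move=> x; rewrite -[sin x]opprK; exact: is_deriveN.
  by rewrite kpi /= (periodicn (@cosD2pi R)).
by rewrite mulr0.
Qed.

End Monomials.

(** * Functions with vanishing arc integrals *)

Section ArcIntegrals.
Context {R : realType}.
Notation mu := (circm R).
Notation leb := (@lebesgue_measure R).
Notation I2pi := `[0%R : R, (2 * pi)%R]%classic.

(** Extended by 0, [a] has a primitive that vanishes on the open interval; by Lebesgue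
    differentiation the derivative of that primitive is [a] almost everywhere. *)
Lemma eq0_of_arc_integrals (a : measurableTypeR R -> R) :
  mu.-integrable setT (EFin \o a) -> Rintegral mu setT a = 0 ->
  (forall b, 0 < b < 2 * pi ->
    Rintegral mu setT (fun t => (b < t)%R%:R * a t) = 0) ->
  {ae mu, forall t, a t = 0}.
Proof.
move=> ia a0 ab0.
have c0 : (2 * pi)^-1 != 0 :> R by rewrite invr_neq0// gt_eqF// two_pi_gt0.
have ma : measurable_fun setT a by apply/measurable_EFinP; exact: measurable_int ia.
have iaI := proj1 (circm_integrableP (measurable_int _ ia)) ia.
have aI0 : Rintegral leb I2pi a = 0.
  by move: a0; rewrite circm_Rintegral// => /eqP; rewrite mulf_eq0 (negPf c0) => /eqP.
have abI0 b : 0 < b < 2 * pi -> Rintegral leb (I2pi `&` `]b, +oo[) a = 0.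
  move=> bI; have := ab0 b bI; rewrite circm_Rintegral; last first.
    apply: le_integrable ia => //.
      apply/measurable_EFinP/measurable_funM => //.
      have -> : (fun t : R => (b < t)%R%:R : R) = \1_(`]b, +oo[).
        by apply/funext => t; rewrite indicE mem_setE in_itv/= andbT.
      exact: measurable_indic.
    move=> t _ /=; rewrite lee_fin normrM.
    by case: (b < t); rewrite ?normr1 ?mul1r// normr0 mul0r.
  move=> /eqP; rewrite mulf_eq0 (negPf c0)/= => /eqP h; rewrite -[RHS]h.
  rewrite Rintegral_mkcondr; apply: eq_Rintegral => t _.
  rewrite patchE mem_setE in_itv/= andbT.
  by case: (b < t); rewrite ?mul1r ?mul0r.
(* The hypothesis concerns the part beyond [b]; subtraction from the whole integral gives the part
   up to [b], which is the primitive. *)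
have abI0' b : 0 < b < 2 * pi -> Rintegral leb (`]-oo, b] `&` I2pi) a = 0.
  move=> bI; have E : I2pi = (I2pi `&` `]-oo, b]) `|` (I2pi `&` `]b, +oo[).
    by rewrite -setIUr -itv_bndbnd_setU// set_itvNyy setIT.
  have := aI0; rewrite E Rintegral_setU//=.
  - by rewrite abI0// addr0 -E setIC.
  - exact: measurableI.
  - exact: measurableI.
  - by rewrite -E.
  - apply/disj_setPS => t [[_ /= tb] [_ /= bt]].
    by move: tb bt; rewrite !in_itv/= andbT ltNge => ->.
pose a' := a \_ I2pi.
have ia' : leb.-integrable setT (EFin \o a').
  by rewrite /a' -restrict_EFin -integrable_restrict// setTI.
have ia'y y : leb.-integrable `]-oo, y] (EFin \o a').
  by apply: integrableS ia'.
apply: ae_circm.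
have := FTC1Ny ia'y (open_integrable_locally openT ia').
apply: filterS; first exact: (ae_filter_ringOfSetsType leb).
move=> x /= [_ dF] /[dup] xI; rewrite in_itv/= => xI'.
have -> : a x = a' x.
  by rewrite /a' patchE mem_set//= in_itv/=; case/andP: xI' => ? ?; rewrite !ltW.
rewrite -dF derive1E (@near_eq_derive _ _ _ _ (cst 0)) ?derive_cst//.
near=> y; rewrite /= /a' -Rintegral_mkcondr abI0'//.
have : y \in `]0, 2 * pi[ by near: y; exact: near_in_itvoo.
by rewrite in_itv.
Unshelve. all: by end_near. Qed.

End ArcIntegrals.

(** * Functions without nonzero Fourier coefficient *)

Section Fourier.
Context {R : realType}.
Notation mu := (circm R).

Definition fourier0 (f : circ R) := L2 f /\ forall n,
  inner f (fexp zvar n) = 0 /\ inner f (fconj (fexp zvar n)) = 0.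

Lemma fexpSz n : fmul zvar (fexp zvar n) = fexp zvar n.+1 :> circ R.
Proof. by apply/funext => t; rewrite /fmul /fexp exprS. Qed.

Lemma fexpSzJ n : fmul (fconj zvar) (fexp zvar n.+1) = fexp zvar n :> circ R.
Proof.
by apply/funext => t; rewrite /fmul /fexp /fconj exprS mulrA [_^*%C * _]mulrC zvarJ mul1r.
Qed.

Lemma fconj_fmul f g : fconj (fmul f g) = fmul (fconj f) (fconj g) :> circ R.
Proof. by circ_ring. Qed.

Lemma fconjK f : fconj (fconj f) = f :> circ R.
Proof. by circ_ring. Qed.

Lemma fexp0 : fexp zvar 0 = (fun=> 1) :> circ R.
Proof. by apply/funext => t; rewrite /fexp expr0. Qed.

(** Multiplication by [z] shifts the coefficients; [n = 0] is the place where a coefficient of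
    nonnegative index becomes one of negative index. With the conjugate shift, the property survives
    multiplication by trigonometric polynomials. *)
Lemma fourier0_z f : fourier0 f -> fourier0 (fmul zvar f).
Proof.
move=> [f2 fn]; split; first exact: L2_zM.
move=> n; rewrite !innerMl; split.
  case: n => [|n]; last by rewrite fexpSzJ; case: (fn n).
  have -> : fmul (fconj zvar) (fexp zvar 0) = fconj (fexp zvar 1) :> circ R.
    by rewrite -fexpSz fconj_fmul fexp0; congr fmul; circ_ring.
  by case: (fn 1%N).
by rewrite -fconj_fmul fexpSz; case: (fn n.+1).
Qed.

Lemma fourier0_zJ f : fourier0 f -> fourier0 (fmul (fconj zvar) f).
Proof.
move=> [f2 fn]; split; first exact: L2_zJM.
move=> n; rewrite !innerMl fconjK; split.
  by rewrite fexpSz; case: (fn n.+1).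
case: n => [|n].
  have -> : fmul zvar (fconj (fexp zvar 0)) = fexp zvar 1 :> circ R.
    by rewrite -fexpSz fexp0; congr fmul; circ_ring.
  by case: (fn 1%N).
rewrite -[zvar]fconjK -fconj_fmul fconjK fexpSzJ; by case: (fn n).
Qed.

Lemma fourier0D f g : fourier0 f -> fourier0 g -> fourier0 (fadd f g).
Proof.
move=> [f2 fn] [g2 gn]; split; first exact: L2D.
have e2 := @L2_fexp R; have e2' n := L2J (e2 n).
by move=> n; rewrite !innerDl//; have [-> ->] := fn n; have [-> ->] := gn n; rewrite addr0.
Qed.

Lemma fourier0Z c f : fourier0 f -> fourier0 (fscale c f).
Proof.
move=> [f2 fn]; split; first exact: L2Z.
have e2 := @L2_fexp R; have e2' n := L2J (e2 n).
by move=> n; rewrite !innerZl//; have [-> ->] := fn n; rewrite mulr0.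
Qed.

(** The cosine centred at the midpoint [b / 2] of the arc and rescaled to take values in [0, 1]. *)
Definition bump (b t : R) : R := (1 + cos (t - b / 2)) / 2.

Lemma fourier0_bump b f : fourier0 f ->
  fourier0 (fmul (fun t => (bump b t)%:C) f).
Proof.
(* [c] is a quarter of [exp (- i b / 2)], so that [bump b] is [c z + conj (c z) + 1 / 2]. *)
move=> Pf; pose c : R[i] := (cos (b / 2) / 4) +i* (- sin (b / 2) / 4).
have -> : fmul (fun t => (bump b t)%:C) f =
  fadd (fscale c (fmul zvar f)) (fadd (fscale c^*%C (fmul (fconj zvar) f))
   (fscale (2^-1)%:C f)).
  apply/funext => t; rewrite /fadd /fscale /fmul !mulrA -!mulrDl; congr (_ * _).
  rewrite /bump cosB /c /fconj /zvar; by simpc; congr (_ +i* _); field.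
apply: fourier0D; first exact/fourier0Z/fourier0_z.
by apply: fourier0D; apply: fourier0Z => //; exact: fourier0_zJ.
Qed.

(* [bump b 0] is the value of [bump b] at both ends of the arc from 0 to [b]. *)
Definition step_poly (b : R) (n : nat) (t : R) : R :=
  (1 - bump b t ^+ n) ^+ Num.truncn (bump b 0 ^- n).

Lemma fourier0_step b n f : fourier0 f ->
  fourier0 (fmul (fun t => (step_poly b n t)%:C) f).
Proof.
have bumpX k g : fourier0 g -> fourier0 (fmul (fun t => (bump b t ^+ k)%:C) g).
  move=> Pg; elim: k => [|k IH].
    have -> // : fmul (fun t => (bump b t ^+ 0)%:C) g = g.
    by apply/funext => t; rewrite /fmul expr0 mul1r.
  have -> : fmul (fun t => (bump b t ^+ k.+1)%:C) g =
     fmul (fun t => (bump b t)%:C) (fmul (fun t => (bump b t ^+ k)%:C) g).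
    by apply/funext => t; rewrite /fmul exprS rmorphM mulrA.
  exact: fourier0_bump.
move=> Pf; rewrite /step_poly; elim: (Num.truncn _) => [|k IH].
  have -> // : fmul (fun t => ((1 - bump b t ^+ n) ^+ 0)%:C) f = f.
  by apply/funext => t; rewrite /fmul expr0 mul1r.
set g := fmul _ f in IH.
have -> : fmul (fun t => ((1 - bump b t ^+ n) ^+ k.+1)%:C) f =
   fadd g (fscale (-1) (fmul (fun t => (bump b t ^+ n)%:C) g)).
  apply/funext => t; rewrite /g /fadd /fscale /fmul exprS rmorphM rmorphB rmorph1.
  by ring.
by apply: fourier0D => //; apply: fourier0Z; exact: bumpX.
Qed.

Lemma fourier0_cintegral f : fourier0 f -> cintegral f = 0.
Proof.
move=> [_ /(_ 0%N)[<- _]]; rewrite /inner; congr cintegral.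
by rewrite fexp0; circ_ring.
Qed.

Lemma bump_itv b t : 0 <= bump b t <= 1.
Proof.
rewrite /bump; have := cos_geN1 (t - b / 2); have := cos_le1 (t - b / 2); lra.
Qed.

Lemma measurable_step_poly b n :
  measurable_fun [set: measurableTypeR R] (step_poly b n).
Proof.
apply: measurable_funX; apply: measurable_funB => //; apply: measurable_funX.
apply: measurable_funM => //; apply: measurable_funD => //.
apply: (measurableT_comp (f := cos)); last exact: measurable_funB.
by apply: continuous_measurable_fun; exact: continuous_cos.
Qed.

Lemma step_poly_itv b n t : 0 <= step_poly b n t <= 1.
Proof.
have /andP[b0 b1] := bump_itv b t.
have h0 := exprn_ge0 n b0; have h1 := exprn_ile1 n b0 b1.
by rewrite exprn_ge0 ?subr_ge0//= exprn_ile1 ?subr_ge0// gerBl.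
Qed.

Lemma cvg_step_poly_arc b t : 0 < b < 2 * pi -> 0 < t < 2 * pi -> t != b ->
  step_poly b n t @[n --> \oo] --> ((b < t)%R%:R : R).
Proof.
move=> bI tI tb.
have bump0 : bump b 0 = (1 + cos (b / 2)) / 2 by rewrite /bump sub0r cosN.
have -> : (b < t) = (bump b t < bump b 0).
  by rewrite bump0 /bump ltr_pM2r// ltrD2l arc_cos.
apply: cvg_step_poly; first exact: bump_itv.
  rewrite bump0; have /andP[b0 b2] := bI.
  have : cos (b / 2) < cos (0 : R).
    by rewrite ltr_cos ?in_itv/=; lra.
  have : cos (pi : R) < cos (b / 2).
    by rewrite ltr_cos ?in_itv/=; lra.
  rewrite cospi cos0; lra.
rewrite bump0 /bump; apply/eqP => h.
have := arc_cos_neq bI tI tb; move=> /eqP; apply; lra.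
Qed.

Lemma ae_neq (b : R) : {ae mu, forall t, t != b}.
Proof.
apply: ae_circm; exists [set b]; split => //.
  exact: lebesgue_measure_set1.
by move=> t /=; apply: contra_notP => /eqP tb _.
Qed.

Lemma step_limit_integral (a : measurableTypeR R -> R) b : 0 < b < 2 * pi ->
  mu.-integrable setT (EFin \o a) ->
  (forall n, Rintegral mu setT (fun t => step_poly b n t * a t) = 0) ->
  Rintegral mu setT (fun t => (b < t)%R%:R * a t) = 0.
Proof.
move=> bI ia H.
have ma : measurable_fun setT a by apply/measurable_EFinP; exact: measurable_int ia.
pose f_ n (t : measurableTypeR R) := (step_poly b n t * a t)%:E.
pose f (t : measurableTypeR R) := ((b < t)%R%:R * a t)%:E.
pose g (t : measurableTypeR R) := `|(a t)%:E|%E.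
have mf_ n : measurable_fun setT (f_ n).
  by apply/measurable_EFinP/measurable_funM => //; exact: measurable_step_poly.
have mf : measurable_fun setT f.
  apply/measurable_EFinP/measurable_funM => //.
  have -> : (fun t : R => (b < t)%R%:R : R) = \1_(`]b, +oo[).
    by apply/funext => t; rewrite indicE mem_setE in_itv/= andbT.
  exact: measurable_indic.
have aecvg : {ae mu, forall x, setT x -> f_ ^~ x @ \oo --> f x}.
  have aeI : {ae mu, forall t, t \in `]0, 2 * pi[} by apply: ae_circm; exact: aeW.
  apply: aeS2 aeI (ae_neq b) => t tI tb _.
  apply/fine_cvgP; split; first exact: nearW.
  apply: cvgM; last exact: cvg_cst.
  by apply: cvg_step_poly_arc => //; move: tI; rewrite in_itv.
have ig : mu.-integrable setT g by exact: integrable_abse.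
have aeg : {ae mu, forall x n, setT x -> (`|f_ n x| <= g x)%E}.
  apply: aeW => t n _; rewrite /f_ /g /= lee_fin normrM ler_piMl//.
  by have /andP[h0 h1] := step_poly_itv b n t; rewrite ger0_norm.
have [if1 _ cv] := dominated_convergence measurableT mf_ mf aecvg ig aeg.
have iz n : (\int[mu]_t f_ n t = 0)%E.
  have := H n; rewrite /Rintegral => h.
  have fin : (\int[mu]_t f_ n t)%E \is a fin_num.
    apply: integrable_fin_num => //.
    apply: le_integrable ig => // t _; rewrite abse_id /f_ /= lee_fin normrM ler_piMl//.
    by have /andP[h0 h1] := step_poly_itv b n t; rewrite ger0_norm.
  by rewrite -(fineK fin) h.
have cz : (\int[mu]_t f_ n t)%E @[n --> \oo] --> 0%E.
  by under eq_fun do rewrite iz; exact: cvg_cst.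
rewrite /Rintegral.
have -> // : (\int[mu]_t f t = 0)%E.
exact: (cvg_unique _ cv cz).
Qed.

(** The step polynomials are real, so the vanishing integrals of their products with [f] split into
    real and imaginary parts, to which the real criterion applies. *)
Lemma fourier_unique f : fourier0 f -> eqm f fzero.
Proof.
move=> Pf; have [f2 _] := Pf.
have cint_L2 g : L2 g -> cint (g : circ R).
  move=> g2; have -> : g = fmul g (fun=> 1) by circ_ring.
  by apply: L2M_cint => //; exact: L2_cst.
have [ir ii] := cint_L2 _ f2.
have re0 : {ae mu, forall t, Re (f t) = 0}.
  apply: (eq0_of_arc_integrals ir).
    by have := fourier0_cintegral Pf => -[].
  move=> b bI; apply: step_limit_integral => // n.
  have := fourier0_cintegral (fourier0_step b n Pf) => -[+ _] => <-.
  by apply: eq_Rintegral => t _; rewrite /fmul creM /= mul0r subr0.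
have im0 : {ae mu, forall t, Im (f t) = 0}.
  apply: (eq0_of_arc_integrals ii).
    by have := fourier0_cintegral Pf => -[].
  move=> b bI; apply: step_limit_integral => // n.
  have := fourier0_cintegral (fourier0_step b n Pf) => -[_ +] => <-.
  by apply: eq_Rintegral => t _; rewrite /fmul cimM /= mul0r addr0.
apply/eqmP; apply: aeS2 re0 im0 => t; rewrite /fzero.
by case: (f t) => x y /= -> ->.
Qed.

End Fourier.

(** * Hardy space and model spaces *)

Section Hardy.
Context {R : realType}.
Notation mu := (circm R).
Implicit Types (f g h theta alpha beta phi : circ R) (S : set (circ R)).

Lemma L2_closed_subspace : closed_subspace (@L2 R).
Proof.
split => //; split; first exact: L2_fzero.
by move=> c f g f2 g2; apply: L2D => //; exact: L2Z.
Qed.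

Lemma closed_annihilator S (I : Type) (P : I -> Prop) (e : I -> circ R) :
  closed_subspace S -> (forall i, P i -> L2 (e i)) ->
  closed_subspace [set f | S f /\ forall i, P i -> inner f (e i) = 0].
Proof.
move=> [S2 lS clS] e2; split; first by move=> f [/S2].
  split.
    by split; [exact: lS.1 | move=> i Pi; rewrite inner0l//; exact: e2].
  move=> c f g [Sf fe] [Sg ge]; split; first exact: lS.2.
  move=> i Pi; rewrite innerDl ?innerZl ?fe ?ge ?mulr0 ?addr0//;
    do ?[exact: L2Z | exact: e2 | exact: S2].
  by apply: L2Z; exact: S2.
move=> f f2 fS; split.
  by apply: clS => // e' e'0; have [s [Ss _] ?] := fS _ e'0; exists s.
move=> i Pi; apply: cabs2_eq0; apply/eqP; rewrite eq_le cabs2_ge0 andbT.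
apply: (@le0_eps _ _ (nsq (e i))) => e' e'0; have [s [Ss sP] sf] := fS _ e'0.
have -> : inner f (e i) = inner (fsub f s) (e i).
  by rewrite innerBl ?sP ?subr0//; [exact: S2|exact: e2].
apply: le_trans (cauchy_schwarz (L2B f2 (S2 _ Ss)) (e2 _ Pi)) _.
by rewrite mulrC ler_wpM2l// nsq_ge0.
Qed.

Lemma closed_subspace_eqm S f g : closed_subspace S -> S f -> L2 g ->
  eqm f g -> S g.
Proof.
move=> [S2 _ clS] Sf g2 fg; apply: clS => // e e0; exists f => //.
have f2 := S2 _ Sf.
rewrite (@nsq_eqm _ _ fzero) ?/nsq ?inner0l ?ltW//; do ?exact: L2_fzero.
  exact: L2B.
by move/eqmP: fg => fg; apply/eqmP; apply: aeS fg => t; rewrite /fsub => ->; rewrite subrr.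
Qed.

Lemma H2_closed : closed_subspace (@H2 R).
Proof.
have -> : @H2 R = [set f | L2 f /\ forall i : nat, True ->
    inner f (fconj (fexp zvar i.+1)) = 0].
  by apply/seteqP; split=> f [f2 fn]; split=> // n *; exact: fn.
apply: closed_annihilator; first exact: L2_closed_subspace.
by move=> n _; exact/L2J/L2_fexp.
Qed.

Lemma H2_L2 f : H2 f -> L2 f. Proof. by case. Qed.

(** What makes multiplication by [theta] isometric on L2. Unlike being inner, it passes to the
    conjugate. *)
Definition unimodular theta :=
  cmeas theta /\ {ae mu, forall t, cabs2 (theta t) = 1}.

Lemma unimodularJ theta : unimodular theta -> unimodular (fconj theta).
Proof.
move=> [mt t1]; split; first exact: cmeasJ.
by apply: aeS t1 => t; rewrite /fconj cabs2J.
Qed.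

Lemma unimodular_zvar : unimodular (zvar : circ R).
Proof. by split; [exact: cmeas_zvar|apply: aeW => t; exact: cabs2_zvar]. Qed.

Lemma L2_unimodular theta f : unimodular theta -> L2 f -> L2 (fmul theta f).
Proof.
by move=> [mt t1]; apply: (@L2_bndM _ _ _ 1) => //; apply: aeS t1 => t ->.
Qed.

Lemma unimodularK theta f : unimodular theta ->
  eqm (fmul (fconj theta) (fmul theta f)) f.
Proof.
move=> [_ t1]; apply/eqmP; apply: aeS t1 => t t1.
by rewrite /fmul /fconj mulrA [_^*%C * _]mulrC -cabs2E t1 mul1r.
Qed.

Lemma inner_unimodular theta f g : unimodular theta -> L2 f -> L2 g ->
  inner (fmul theta f) (fmul theta g) = inner f g.
Proof.
move=> ut f2 g2; rewrite innerMl; apply: inner_eqm => //.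
- by apply: L2_unimodular; [exact: unimodularJ | exact: L2_unimodular].
- exact: eqm_refl.
- exact: unimodularK.
Qed.

Lemma nsq_unimodular theta f : unimodular theta -> L2 f ->
  nsq (fmul theta f) = nsq f.
Proof. by move=> ut f2; rewrite /nsq inner_unimodular. Qed.

Lemma inner_function_unimodular theta : inner_function theta -> unimodular theta.
Proof.
move=> [[[t2 _] _] t1]; split; first exact: L2_cmeas.
by apply: aeS t1 => t /norm1_cabs2.
Qed.

Lemma inner_function_H2 theta : inner_function theta -> H2 theta.
Proof. by move=> [[]]. Qed.

Lemma fexp_mul m n : fmul (fexp zvar m) (fexp zvar n) = fexp zvar (m + n) :> circ R.
Proof. by apply/funext => t; rewrite /fmul /fexp exprD. Qed.

Lemma cintegral_inner f g : inner f (fconj g) = cintegral (fmul f g).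
Proof. by rewrite /inner fconjK. Qed.

Lemma H2_fexp n : H2 (fexp zvar n : circ R).
Proof.
split; first exact: L2_fexp.
by move=> m; rewrite cintegral_inner fexp_mul addnS cintegral_fexp.
Qed.

Lemma H2_zM f : H2 f -> H2 (fmul zvar f).
Proof.
move=> [f2 fn]; split; first exact: L2_zM.
by move=> m; rewrite innerMl -fconj_fmul fexpSz.
Qed.

(* The projection of [v] on [H2] has no nonzero Fourier coefficient. *)
Lemma orthogonal_H2 v h : L2 v -> (forall n, inner v (fexp zvar n) = 0) ->
  H2 h -> inner v h = 0.
Proof.
move=> v2 vn Hh; have [g Hg gP] := orthogonal_projection H2_closed v2.
have g2 := H2_L2 Hg; have h2 := H2_L2 Hh.
have g0 : eqm g fzero.
  apply: fourier_unique; split => // n.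
  have gn k : inner g (fexp zvar k) = 0.
    have := gP _ (H2_fexp k); rewrite innerBl//; last exact: L2_fexp.
    by rewrite vn sub0r => /eqP; rewrite oppr_eq0 => /eqP.
  split => //; case: n => [|n]; last by case: Hg.
  have -> : fconj (fexp zvar 0) = fexp zvar 0 :> circ R by rewrite fexp0; circ_ring.
  exact: gn.
have := gP _ Hh; rewrite innerBl// (inner_eqm g2 (L2_fzero) h2 h2 g0 (eqm_refl _)).
by rewrite inner0l// subr0.
Qed.

(** A negative coefficient of [alpha * h] is the product of [h] with [conj alpha * conj z^(m+1)].
    All frequencies of the latter are negative, so it is orthogonal to [H2]. *)
Lemma inner_functionM alpha h : inner_function alpha -> H2 h -> H2 (fmul alpha h).
Proof.
move=> ia Hh; have ua := inner_function_unimodular ia; have h2 := H2_L2 Hh.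
split; first exact: L2_unimodular.
move=> m; set e := fconj (fexp zvar m.+1).
have e2 : L2 e by exact/L2J/L2_fexp.
have ae2 : L2 (fmul (fconj alpha) e) by apply: L2_unimodular => //; exact: unimodularJ.
rewrite innerMl (innerC ae2 h2) (@orthogonal_H2 _ h) ?conjc0// => n.
have -> : inner (fmul (fconj alpha) e) (fexp zvar n) =
    inner (fconj alpha) (fconj (fconj (fexp zvar (m.+1 + n)))).
  rewrite fconjK -fexp_mul /e /inner; congr cintegral; circ_ring.
rewrite innerJJ; [|exact: H2_L2 (inner_function_H2 ia)|exact/L2J/L2_fexp].
by case: (inner_function_H2 ia) => _ ->; rewrite conjc0.
Qed.

(** * Model spaces, their bounded elements and their conjugation *)

Section ModelSpace.
Variables (theta : circ R) (it : inner_function theta).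
Let ut := inner_function_unimodular it.

Lemma Ksp_closed : closed_subspace (Ksp theta).
Proof.
apply: (@closed_annihilator H2 _ H2 (fmul theta)); first exact: H2_closed.
by move=> h /H2_L2; exact: L2_unimodular.
Qed.

Lemma Ksp_L2 f : Ksp theta f -> L2 f.
Proof. by case=> /H2_L2. Qed.

Lemma Ksp_H2 f : Ksp theta f -> H2 f.
Proof. by case. Qed.

Lemma Ksp_eq0 f : Ksp theta f -> (forall g, Ksp theta g -> inner f g = 0) ->
  eqm f fzero.
Proof. by move=> Kf H; apply: inner_eq0; [exact: Ksp_L2|exact: H]. Qed.

Lemma Ksp_eqm_of_inner f g : Ksp theta f -> Ksp theta g ->
  (forall h, Ksp theta h -> inner f h = inner g h) -> eqm f g.
Proof.
move=> Kf Kg H; have [_ lK _] := Ksp_closed.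
have : eqm (fsub f g) fzero.
  apply: Ksp_eq0; first exact: subspaceB.
  by move=> h Kh; rewrite innerBl ?H ?subrr//; exact: Ksp_L2.
move=> /eqmP h; apply/eqmP; apply: aeS h => t.
by move=> /eqP; rewrite subr_eq0 => /eqP.
Qed.

Definition bounded_ae f := exists M, {ae mu, forall t, cabs2 (f t) <= M}.

Lemma bounded_aeD f g : bounded_ae f -> bounded_ae g -> bounded_ae (fadd f g).
Proof.
move=> [M fM] [N gN]; exists (2 * M + 2 * N); apply: aeS2 fM gN => t fM gN.
apply: le_trans (cabs2D_le _ _) _; lra.
Qed.

Lemma bounded_aeM f g : bounded_ae f -> bounded_ae g -> bounded_ae (fmul f g).
Proof.
move=> [M fM] [N gN]; exists (M * N); apply: aeS2 fM gN => t fM gN.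
by rewrite cabs2M ler_pM// cabs2_ge0.
Qed.

Lemma bounded_ae_cst (c : R[i]) : bounded_ae (fun=> c).
Proof. by exists (cabs2 c); apply: aeW. Qed.

Lemma bounded_aeZ c f : bounded_ae f -> bounded_ae (fscale c f).
Proof. exact: (@bounded_aeM (fun=> c)) (bounded_ae_cst c). Qed.

Lemma bounded_aeJ f : bounded_ae f -> bounded_ae (fconj f).
Proof. by move=> [M fM]; exists M; apply: aeS fM => t; rewrite cabs2J. Qed.

Lemma unimodular_bounded alpha : unimodular alpha -> bounded_ae alpha.
Proof. by move=> [_ a1]; exists 1; apply: aeS a1 => t ->. Qed.

Lemma bounded_ae_L2 f g : cmeas f -> bounded_ae f -> L2 g -> L2 (fmul g f).
Proof.
move=> mf [M fM] g2; have -> : fmul g f = fmul f g by circ_ring.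
exact: L2_bndM fM g2.
Qed.

Definition Kinfty := [set f | Ksp theta f /\ bounded_ae f].

Lemma Kinfty_sub : Kinfty `<=` Ksp theta. Proof. by move=> f []. Qed.

Lemma Kinfty_subspace : linear_subspace Kinfty.
Proof.
have [_ lK _] := Ksp_closed; split.
  by split; [exact: lK.1|exact: (bounded_ae_cst 0)].
move=> c f g [Kf bf] [Kg bg]; split; first exact: lK.2.
by apply: bounded_aeD => //; exact: bounded_aeZ.
Qed.

(* A polynomial [p] such that the projection of [z^n] on the model space is
   [z^n - theta p]; it is the analytic part of [conj theta * z^n]. *)
Lemma analytic_part n : exists p, [/\ H2 p, bounded_ae p &
  forall j, inner (fsub (fmul (fconj theta) (fexp zvar n)) p) (fexp zvar j) = 0].
Proof.
have lH : linear_subspace (@H2 R) by have [] := H2_closed.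
have t2 := H2_L2 (inner_function_H2 it).
have one2 : L2 (fexp zvar 0 : circ R) by exact: L2_fexp.
have one1 : inner (fexp zvar 0) (fexp zvar 0) = 1 :> R[i].
  rewrite inner_nsq// nsqE fexp0 /=.
  have -> : (fun _ : R => cabs2 (1 : R[i])) = (fun=> 1).
    by apply/funext => t; rewrite /cabs2 /= expr1n expr0n addr0.
  rewrite Rintegral_cst// mul1r.
  by rewrite [X in fine X](_ : _ = 1%E)//; exact: probability_setT.
have oneS j : inner (fexp zvar 0) (fexp zvar j.+1) = 0 :> R[i].
  rewrite (innerC (L2_fexp _) one2) -[X in inner _ X]fconjK.
  rewrite cintegral_inner.
  have -> : fmul (fexp zvar j.+1) (fconj (fexp zvar 0)) = fexp zvar j.+1 :> circ R.
    by rewrite fexp0; circ_ring.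
  by rewrite cintegral_fexp conjc0.
have step (v : circ R) : L2 v -> (forall j, inner v (fexp zvar j.+1) = 0) ->
    forall j, inner (fsub v (fscale (inner v (fexp zvar 0)) (fexp zvar 0)))
      (fexp zvar j) = 0.
  move=> v2 vj j; have e2 := L2_fexp (R := R) j.
  have c2 := L2Z (inner v (fexp zvar 0)) one2.
  rewrite (innerBl v2 c2 e2) (innerZl _ one2 e2).
  by case: j e2 => [|j] e2; rewrite ?one1 ?mulr1 ?subrr// vj oneS mulr0 subr0.
have b1 : bounded_ae (fexp zvar 0) by rewrite fexp0; exact: bounded_ae_cst.
(* For [n = 0] the analytic part is the constant term, as [conj theta] has no positive frequency. In
   the step, [w] has only negative frequencies, so [z * w] has none above 0 and its constant term
   [c] is the only correction to [z * p]. *)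
elim: n => [|n [p [Hp bp pj]]].
  set v := fmul (fconj theta) _.
  have v2 : L2 v by apply: L2_unimodular => //; exact: unimodularJ.
  exists (fscale (inner v (fexp zvar 0)) (fexp zvar 0)); split.
  - by apply: subspaceZ => //; exact: H2_fexp.
  - exact: bounded_aeZ.
  apply: step => // j.
  have -> : v = fconj theta by rewrite /v fexp0; circ_ring.
  rewrite -[fexp zvar j.+1]fconjK innerJJ//; last exact/L2J/L2_fexp.
  by case: (inner_function_H2 it) => _ ->; rewrite conjc0.
set w := fsub _ p in pj.
have p2 := H2_L2 Hp.
have w2 : L2 w.
  by apply: L2B => //; apply: L2_unimodular; [exact: unimodularJ|exact: L2_fexp].
pose c := inner (fmul zvar w) (fexp zvar 0).
exists (fadd (fmul zvar p) (fscale c (fexp zvar 0))); split.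
- by apply: subspaceD => //; [exact: H2_zM|apply: subspaceZ => //; exact: H2_fexp].
- apply: bounded_aeD; last exact: bounded_aeZ.
  by apply: bounded_aeM => //; exact/unimodular_bounded/unimodular_zvar.
have -> : fsub (fmul (fconj theta) (fexp zvar n.+1))
     (fadd (fmul zvar p) (fscale c (fexp zvar 0))) =
   fsub (fmul zvar w) (fscale c (fexp zvar 0)).
  by rewrite -fexpSz /w; circ_ring.
apply: step; first exact: L2_zM.
by move=> j; rewrite innerMl fexpSzJ.
Qed.

Lemma Kinfty_dense : dense_in Kinfty (Ksp theta).
Proof.
apply: dense_of_orthogonal; [exact: Ksp_closed|exact: Kinfty_sub|exact: Kinfty_subspace|].
move=> f Kf fKb; have f2 := Ksp_L2 Kf.
apply: fourier_unique; split => // n.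
have fn k : inner f (fexp zvar k) = 0.
  have [p [Hp bp pj]] := analytic_part k.
  have p2 := H2_L2 Hp; have tp2 := L2_unimodular ut p2; have e2 := L2_fexp (R := R) k.
  (* Orthogonality to [theta * h] reduces to that of [conj theta * z^k - p] to [h]. Since [f] is
     itself orthogonal to [theta * p], testing it against this function isolates its coefficient at
     [k]. *)
  have Kk : Kinfty (fsub (fexp zvar k) (fmul theta p)).
    split; last first.
      rewrite fsubE; apply: bounded_aeD.
        by exists 1; apply: aeW => t; rewrite cabs2_fexp_zvar.
      by apply: bounded_aeZ; apply: bounded_aeM => //; exact: unimodular_bounded.
    split.
      have [_ lH _] := H2_closed; apply: subspaceB => //; first exact: H2_fexp.
      exact: inner_functionM.
    move=> h Hh; have h2 := H2_L2 Hh.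
    rewrite innerBl//; last exact: L2_unimodular.
    rewrite inner_unimodular// innerMr -innerBl//; last first.
      by apply: L2_unimodular => //; exact: unimodularJ.
    apply: orthogonal_H2 => //.
    by apply: L2B => //; apply: L2_unimodular => //; exact: unimodularJ.
  have := fKb _ Kk; rewrite innerBr//.
  by case: Kf => _ /(_ _ Hp) ->; rewrite subr0.
split => //; case: n => [|n]; last by case: Kf => -[_ H] _; exact: H.
have -> : fconj (fexp zvar 0) = fexp zvar 0 :> circ R by rewrite fexp0; circ_ring.
exact: fn.
Qed.

Lemma proj_spec f : L2 f -> Ksp theta (Defs.proj theta f) /\
  forall h, Ksp theta h -> inner (fsub f (Defs.proj theta f)) h = 0.
Proof.
move=> f2; have [g Kg gP] := orthogonal_projection Ksp_closed f2.
rewrite /Defs.proj; case: xgetP => [? -> //|/(_ g) []].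
by split.
Qed.

Lemma inner_proj f h : L2 f -> Ksp theta h -> inner (Defs.proj theta f) h = inner f h.
Proof.
move=> f2 Kh; have [Kp /(_ h Kh)] := proj_spec f2.
rewrite innerBl//; [|exact: Ksp_L2..].
by move=> /eqP; rewrite subr_eq0 => /eqP.
Qed.

(** The two defining conditions trade places. The negative coefficients of the image are conjugates
    of products of [f] with [theta * z^m]; orthogonality of the image to [theta * h] becomes
    orthogonality of [f] to [conj (z * h)], which has only negative frequencies. *)
Lemma conjugation_Ksp f : Ksp theta f -> Ksp theta (conjugation theta f).
Proof.
move=> Kf; have Hf := Ksp_H2 Kf; have f2 := H2_L2 Hf.
have uzJ := unimodularJ unimodular_zvar.
have C2 : L2 (conjugation theta f).
  by apply: L2_unimodular => //; apply: L2_unimodular => //; exact: L2J.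
split.
  split => // m.
  have -> : inner (conjugation theta f) (fconj (fexp zvar m.+1)) =
      inner (fmul theta (fexp zvar m)) f.
    rewrite -(fexpSzJ m) /inner; congr cintegral; rewrite /conjugation; circ_ring.
  rewrite (innerC f2 (L2_unimodular ut (L2_fexp m))).
  by case: Kf => _ ->; rewrite ?conjc0//; exact: H2_fexp.
move=> h Hh; have h2 := H2_L2 Hh.
rewrite inner_unimodular//; last by apply: L2_unimodular => //; exact: L2J.
have -> : inner (fmul (fconj zvar) (fconj f)) h = inner (fconj (fmul zvar h)) f.
  by rewrite /inner; congr cintegral; circ_ring.
apply: orthogonal_H2 => //; first exact/L2J/L2_zM.
move=> n; have -> : inner (fconj (fmul zvar h)) (fexp zvar n) =
   inner (fconj h) (fconj (fconj (fexp zvar n.+1))).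
  by rewrite fconjK -fexpSz /inner; congr cintegral; circ_ring.
rewrite innerJJ//; last exact/L2J/L2_fexp.
by case: Hh => _ ->; rewrite conjc0.
Qed.

End ModelSpace.
End Hardy.

(** * Asymmetric truncated Toeplitz operators *)

Section ToeplitzOperators.
Context {R : realType}.
Notation mu := (circm R).
Implicit Types (f g h theta alpha beta phi : circ R) (S : set (circ R)).

Lemma eqm_fadd (f f' g g' : circ R) : eqm f f' -> eqm g g' -> eqm (fadd f g) (fadd f' g').
Proof.
move=> /eqmP ff /eqmP gg; apply/eqmP; apply: aeS2 ff gg => t.
by rewrite /fadd => -> ->.
Qed.

Lemma eqm_fmul (f g h : circ R) : eqm f g -> eqm (fmul h f) (fmul h g).
Proof.
by move=> /eqmP fg; apply/eqmP; apply: aeS fg => t; rewrite /fmul => ->.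
Qed.

Lemma eqm_fscale c (f g : circ R) : eqm f g -> eqm (fscale c f) (fscale c g).
Proof. exact: eqm_fmul. Qed.

(** An operator acts on functions and could a priori distinguish two representatives; boundedness
    forces it to send a null difference to a null function. *)
Lemma linear_on_eqm S K (A : op R) f g : closed_subspace S -> closed_subspace K ->
  linear_on S K A -> bounded_on S A -> S f -> S g -> eqm f g -> eqm (A f) (A g).
Proof.
move=> [S2 lS _] [K2 _ _] [AK Al] /bounded_onP[M M0 AM] Sf Sg fg.
have f2 := S2 _ Sf; have g2 := S2 _ Sg.
have Af2 := K2 _ (AK _ Sf); have Ag2 := K2 _ (AK _ Sg).
have Sgf := subspaceB lS Sg Sf.
have z : nsq (fsub g f) = 0.
  rewrite (@nsq_eqm _ _ fzero) ?/nsq ?inner0l//; do ?exact: L2_fzero.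
    exact: L2B.
  by move/eqmP: fg => fg; apply/eqmP; apply: aeS fg => t; rewrite /fsub => ->; rewrite subrr.
have /eqmP Az : eqm (A (fsub g f)) fzero.
  apply: nsq_eq0; first by apply: K2; exact: AK.
  by apply/eqP; rewrite eq_le nsq_ge0 andbT -(mulr0 M) -z; exact: AM.
have /eqmP Alin := Al (-1) f g Sf Sg.
apply/eqmP; apply: aeS2 Az Alin => t.
have -> : fadd (fscale (-1) f) g = fsub g f by circ_ring.
by move=> ->; rewrite /fzero /fadd /fscale => /esym/eqP; rewrite mulN1r addrC subr_eq0 => /eqP.
Qed.

Lemma att_dom_subspace theta phi : inner_function theta ->
  linear_subspace (att_dom theta phi).
Proof.
move=> it; have [_ lK _] := Ksp_closed it; split.
  split; first exact: lK.1.
  have -> : fmul phi fzero = fzero by circ_ring.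
  exact: L2_fzero.
move=> c f g [Kf f2] [Kg g2]; split; first exact: lK.2.
have -> : fmul phi (fadd (fscale c f) g) = fadd (fscale c (fmul phi f)) (fmul phi g).
  by circ_ring.
by apply: L2D => //; exact: L2Z.
Qed.

Lemma Kinfty_att_dom theta phi f : L2 phi -> Kinfty theta f -> att_dom theta phi f.
Proof.
move=> phi2 [Kf bf]; split => //.
by apply: bounded_ae_L2 => //; exact: L2_cmeas (Ksp_L2 Kf).
Qed.

Section Att.
Variables (theta alpha phi : circ R).
Hypotheses (it : inner_function theta) (ia : inner_function alpha).
Hypotheses (phi2 : L2 phi) (bd : att_bounded theta alpha phi).
Notation A := (att theta alpha phi).

Lemma att_pre_linear : linear_on (att_dom theta phi) (Ksp alpha) (att_pre alpha phi).
Proof.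
have [_ lK _] := Ksp_closed ia; rewrite /att_pre; split.
  by move=> f [_ f2]; have [] := proj_spec ia f2.
move=> c f g [Kf f2] [Kg g2].
have [_ fg2] := (att_dom_subspace phi it).2 c f g (conj Kf f2) (conj Kg g2).
have [Kpf _] := proj_spec ia f2; have [Kpg _] := proj_spec ia g2.
apply: (Ksp_eqm_of_inner ia); first by have [] := proj_spec ia fg2.
  exact: lK.2.
move=> h Kh; have h2 := Ksp_L2 Kh; rewrite inner_proj//.
have -> : fmul phi (fadd (fscale c f) g) = fadd (fscale c (fmul phi f)) (fmul phi g).
  by circ_ring.
rewrite innerDl ?innerZl//; last exact: L2Z.
have pf2 := Ksp_L2 Kpf; have pg2 := Ksp_L2 Kpg.
rewrite [RHS]innerDl//; last exact: L2Z.
by rewrite innerZl// !inner_proj.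
Qed.

(** The natural domain contains [Kinfty theta] and is therefore dense, so a bounded extension exists
    and the default in [att] is not taken. *)
Lemma att_spec : [/\ linear_on (Ksp theta) (Ksp alpha) A,
  bounded_on (Ksp theta) A & op_eq (att_dom theta phi) A (att_pre alpha phi)].
Proof.
have [A0 [A1 A2 A3]] : exists A0 : op R, [/\ linear_on (Ksp theta) (Ksp alpha) A0,
    bounded_on (Ksp theta) A0 & op_eq (att_dom theta phi) A0 (att_pre alpha phi)].
  apply: bounded_extension => //; [exact: Ksp_closed|exact: Ksp_closed| | | |].
  - by move=> f [].
  - exact: att_dom_subspace.
  - move=> f e Kf e0; have [d Dd df] := Kinfty_dense it Kf e0.
    by exists d => //; exact: Kinfty_att_dom.
  - exact: att_pre_linear.
rewrite /att; case: xgetP => [X -> [? [? ?]] //|/(_ A0) []].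
by split.
Qed.

Lemma att_Ksp f : Ksp theta f -> Ksp alpha (A f).
Proof. by case: att_spec => [[AK _] _ _]; exact: AK. Qed.

Lemma inner_att f g : Ksp theta f -> L2 (fmul phi f) -> Ksp alpha g ->
  inner (A f) g = inner (fmul phi f) g.
Proof.
move=> Kf f2 Kg; have [_ _ AP] := att_spec.
have [Kp _] := proj_spec ia f2.
rewrite -(inner_proj ia f2 Kg); apply: inner_eqm; do ?exact: Ksp_L2.
- exact: Ksp_L2 (att_Ksp Kf).
- exact: Ksp_L2 Kp.
- exact: Ksp_L2 Kg.
- exact: Ksp_L2 Kg.
- exact: AP.
- exact: eqm_refl.
Qed.

End Att.

Lemma linear_onB S K (A : op R) f g : linear_on S K A -> S f -> S g ->
  eqm (A (fsub f g)) (fsub (A f) (A g)).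
Proof.
move=> [_ Al] Sf Sg; have := Al (-1) g f Sg Sf.
have -> : fadd (fscale (-1) g) f = fsub f g by circ_ring.
suff -> : fadd (fscale (-1) (A g)) (A f) = fsub (A f) (A g) by [].
by circ_ring.
Qed.

Lemma adjoint_extension S T D E (A B : op R) :
  closed_subspace S -> closed_subspace T ->
  D `<=` S -> dense_in D S -> E `<=` T -> dense_in E T ->
  linear_on S T A -> bounded_on S A -> linear_on T S B -> bounded_on T B ->
  (forall f g, D f -> E g -> inner (A f) g = inner f (B g)) ->
  forall f g, S f -> T g -> inner (A f) g = inner f (B g).
Proof.
move=> [S2 lS _] [T2 lT _] DS dD ET dE lA /bounded_onP[M M0 AM] lB
  /bounded_onP[N N0 BN] H.
have [AT _] := lA; have [BS _] := lB.
have half f g : S f -> E g -> inner (A f) g = inner f (B g).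
  move=> Sf Eg; apply/eqP; rewrite -subr_eq0; apply/eqP; have Tg := ET _ Eg.
  have g2 := T2 _ Tg; have Bg2 := S2 _ (BS _ Tg).
  pose l f := inner (A f) g - inner f (B g).
  apply: (@dense_vanish _ S D l (2 * M * nsq g + 2 * nsq (B g))) => // {Sf}f d Sf Dd.
  have Sd := DS _ Dd; have f2 := S2 _ Sf; have d2 := S2 _ Sd.
  have Sfd := subspaceB lS Sf Sd.
  have Af2 := T2 _ (AT _ Sf); have Ad2 := T2 _ (AT _ Sd); have Afd2 := T2 _ (AT _ Sfd).
  have -> : l f = inner (A (fsub f d)) g + - inner (fsub f d) (B g).
    rewrite (inner_eqm Afd2 (L2B Af2 Ad2) g2 g2 (linear_onB lA Sf Sd) (eqm_refl _)).
    rewrite !innerBl// (H d g Dd Eg) /l; ring.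
  apply: le_trans (cabs2D_le _ _) _; rewrite cabs2N.
  have h1 := cauchy_schwarz Afd2 g2.
  have h2 := cauchy_schwarz (S2 _ Sfd) Bg2.
  have : nsq (A (fsub f d)) * nsq g <= M * nsq (fsub f d) * nsq g.
    by rewrite ler_wpM2r ?nsq_ge0// AM.
  move: h1 h2; lra.
move=> f g Sf Tg; apply/eqP; rewrite -subr_eq0; apply/eqP.
have f2 := S2 _ Sf; have Af2 := T2 _ (AT _ Sf).
pose l g := inner (A f) g - inner f (B g).
apply: (@dense_vanish _ T E l (2 * N * nsq f + 2 * nsq (A f))) => // {Tg}g d Tg Ed.
have Td := ET _ Ed; have g2 := T2 _ Tg; have d2 := T2 _ Td.
have Tgd := subspaceB lT Tg Td.
have Bg2 := S2 _ (BS _ Tg); have Bd2 := S2 _ (BS _ Td); have Bgd2 := S2 _ (BS _ Tgd).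
have -> : l g = inner (A f) (fsub g d) + - inner f (B (fsub g d)).
  rewrite (inner_eqm f2 f2 Bgd2 (L2B Bg2 Bd2) (eqm_refl _) (linear_onB lB Tg Td)).
  rewrite !innerBr// (half f d Sf Ed) /l; ring.
apply: le_trans (cabs2D_le _ _) _; rewrite cabs2N.
have h1 := cauchy_schwarz Af2 (T2 _ Tgd).
have h2 := cauchy_schwarz f2 Bgd2.
have : nsq f * nsq (B (fsub g d)) <= nsq f * (N * nsq (fsub g d)).
  by rewrite ler_wpM2l ?nsq_ge0// BN.
move: h1 h2; lra.
Qed.

(** For bounded [f] and [g] both sides are the integral of [phi * f * conj g]; density in both model
    spaces does the rest. *)
Lemma att_adjoint theta alpha phi f g :
  inner_function theta -> inner_function alpha -> L2 phi ->
  att_bounded theta alpha phi -> att_bounded alpha theta (fconj phi) ->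
  Ksp theta f -> Ksp alpha g ->
  inner (att theta alpha phi f) g = inner f (att alpha theta (fconj phi) g).
Proof.
move=> it ia phi2 b1 b2; have phiJ2 := L2J phi2.
have [A1 A2 _] := att_spec it ia phi2 b1.
have [B1 B2 _] := att_spec ia it phiJ2 b2.
apply: (adjoint_extension (Ksp_closed it) (Ksp_closed ia) (@Kinfty_sub _ theta) (Kinfty_dense it)
  (@Kinfty_sub _ alpha) (Kinfty_dense ia) A1 A2 B1 B2) => {}f {}g Kbf Kbg.
have [Kf f2] := Kinfty_att_dom phi2 Kbf; have [Kg g2] := Kinfty_att_dom phiJ2 Kbg.
rewrite inner_att// (innerC (Ksp_L2 (att_Ksp ia it phiJ2 b2 Kg)) (Ksp_L2 Kf)).
rewrite inner_att// -(innerC g2 (Ksp_L2 Kf)).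
by rewrite innerMl.
Qed.

End ToeplitzOperators.

(** * Conjugations and the decomposition of a model space *)

Section Decomposition.
Context {R : realType}.
Notation mu := (circm R).
Implicit Types (f g h phi psi : circ R).

Lemma conjugation_sym theta f g :
  inner (conjugation theta f) g = inner (conjugation theta g) f.
Proof. by rewrite /inner; congr cintegral; rewrite /conjugation; circ_ring. Qed.

Lemma conjugation_antilinear theta c f g :
  conjugation theta (fadd (fscale c f) g) =
  fadd (fscale c^*%C (conjugation theta f)) (conjugation theta g).
Proof. by rewrite /conjugation; circ_ring. Qed.

Lemma conjugation_eqm theta f g : eqm f g ->
  eqm (conjugation theta f) (conjugation theta g).
Proof.
move=> /eqmP fg; apply/eqmP; apply: aeS fg => t.
by rewrite /conjugation /fmul /fconj => ->.
Qed.

Lemma nsqJ f : nsq (fconj f) = nsq f.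
Proof. by rewrite !nsqE; apply: eq_Rintegral => t _; rewrite cabs2J. Qed.

Lemma nsq_conjugation theta f : inner_function theta -> L2 f ->
  nsq (conjugation theta f) = nsq f.
Proof.
move=> it f2; have ut := inner_function_unimodular it.
have uz := unimodularJ (@unimodular_zvar R).
have fJ2 := L2J f2; have zfJ2 := L2_unimodular uz fJ2.
by rewrite /conjugation !nsq_unimodular// nsqJ.
Qed.

Lemma bounded_conjugation theta f : inner_function theta -> bounded_ae f ->
  bounded_ae (conjugation theta f).
Proof.
move=> it bf; have ut := inner_function_unimodular it.
have uz := unimodularJ (@unimodular_zvar R).
apply: bounded_aeM; first exact: unimodular_bounded.
by apply: bounded_aeM; [exact: unimodular_bounded|exact: bounded_aeJ].
Qed.

Lemma bounded_ae_eqm f g : eqm f g -> bounded_ae f -> bounded_ae g.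
Proof.
by move=> /eqmP fg [M fM]; exists M; apply: aeS2 fg fM => t ->.
Qed.

Variables alpha theta : circ R.
Hypotheses (ia : inner_function alpha) (it : inner_function theta).
Hypothesis hdiv : inner_divides alpha theta.
Notation beta := (fdiv theta alpha).
Let ib : inner_function beta := hdiv.
Let ua := inner_function_unimodular ia.

(** Division by 0 spoils the factorization where [alpha] vanishes, hence the equality only where
    [alpha] has modulus 1. *)
Lemma inner_divides_eqm : eqm theta (fmul alpha beta).
Proof.
have [_ a1] := ua; apply/eqmP; apply: aeS a1 => t a1.
rewrite /fmul /fdiv mulrCA divff ?mulr1//.
by apply/eqP => a0; move: a1 => /eqP; rewrite a0 /cabs2 /= expr0n addr0 eq_sym oner_eq0.
Qed.

Lemma inner_theta f h : L2 f -> L2 h ->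
  inner f (fmul theta h) = inner f (fmul alpha (fmul beta h)).
Proof.
move=> f2 h2; apply: inner_eqm => //.
- exact: L2_unimodular (inner_function_unimodular it) _.
- by apply: L2_unimodular => //; exact: L2_unimodular (inner_function_unimodular ib) _.
- exact: eqm_refl.
have /eqmP tab := inner_divides_eqm; apply/eqmP; apply: aeS tab => t.
by rewrite /fmul => ->; rewrite mulrA.
Qed.

Lemma Ksp_orthogonal f1 f2 : Ksp alpha f1 -> Ksp beta f2 ->
  inner f1 (fmul alpha f2) = 0.
Proof. by move=> [_ h] [H _]; exact: h. Qed.

Lemma L2_alphaM f : Ksp beta f -> L2 (fmul alpha f).
Proof. by move=> /Ksp_L2; exact: L2_unimodular. Qed.

Lemma inner_sum f1 f2 g1 g2 : Ksp alpha f1 -> Ksp beta f2 ->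
  Ksp alpha g1 -> Ksp beta g2 ->
  inner (fadd f1 (fmul alpha f2)) (fadd g1 (fmul alpha g2)) =
  inner f1 g1 + inner f2 g2.
Proof.
move=> K1 K2 L1 M2; have f12 := Ksp_L2 K1; have f22 := Ksp_L2 K2.
have g12 := Ksp_L2 L1; have g22 := Ksp_L2 M2.
have af2 := L2_alphaM K2; have ag2 := L2_alphaM M2.
rewrite innerDl//; last exact: L2D.
rewrite !innerDr// (Ksp_orthogonal K1 M2) (innerC g12 af2) (Ksp_orthogonal L1 K2).
by rewrite conjc0 addr0 add0r inner_unimodular.
Qed.

Lemma nsq_sum f1 f2 : Ksp alpha f1 -> Ksp beta f2 ->
  nsq (fadd f1 (fmul alpha f2)) = nsq f1 + nsq f2.
Proof. by move=> K1 K2; rewrite /nsq inner_sum// creD. Qed.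

Lemma Ksp_sum f1 f2 : Ksp alpha f1 -> Ksp beta f2 ->
  Ksp theta (fadd f1 (fmul alpha f2)).
Proof.
move=> K1 K2; have H1 := Ksp_H2 K1; have H2' := Ksp_H2 K2.
have [_ lH _] := H2_closed (R := R); split.
  by apply: subspaceD => //; exact: inner_functionM.
move=> h Hh; have h2 := H2_L2 Hh; have f12 := H2_L2 H1; have f22 := H2_L2 H2'.
have af2 := L2_alphaM K2.
have bh2 : L2 (fmul beta h) by exact: L2_unimodular (inner_function_unimodular ib) _.
rewrite innerDl//; last exact: L2_unimodular (inner_function_unimodular it) _.
rewrite !inner_theta// inner_unimodular//.
case: K1 => _ ->; last exact: inner_functionM.
by case: K2 => _ ->; rewrite ?addr0.
Qed.

(** The components are the projection [f1] of [f] on [Ksp alpha] and [conj alpha * (f - f1)]. That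
    the second one is analytic is the main point. *)
Lemma components_exist f : Ksp theta f -> exists p : circ R * circ R,
  Ksp alpha p.1 /\ Ksp beta p.2 /\ eqm f (fadd p.1 (fmul alpha p.2)).
Proof.
move=> Kf; have f2 := Ksp_L2 Kf; have Hf := Ksp_H2 Kf.
have [_ lH _] := H2_closed (R := R).
have [K1 P1] := proj_spec ia f2; set f1 := Defs.proj alpha f in K1 P1.
have f12 := Ksp_L2 K1; have H1 := Ksp_H2 K1.
set r := fsub f f1 in P1; have Hr : H2 r by exact: subspaceB.
have r2 := H2_L2 Hr; have uaJ := unimodularJ ua.
have ub := inner_function_unimodular ib.
exists (f1, fmul (fconj alpha) r) => /=; split=> //; split; last first.
  have /eqmP e := unimodularK r uaJ; apply/eqmP; apply: aeS e => t.
  by rewrite fconjK /fadd => ->; rewrite /r /fsub addrC subrK.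
split; first split.
- exact: L2_unimodular.
- move=> m; set e := fconj (fexp zvar m.+1).
  have e2 : L2 e by exact/L2J/L2_fexp.
  rewrite innerMl fconjK; set w := fmul alpha e.
  have w2 : L2 w by exact: L2_unimodular.
  (* The coefficient is [<r, w>]. The [H2] part [g] of [w] lies in [Ksp alpha], because
     [<w, alpha h>] is the product of [conj z^(m+1)] and [h]. So [r] is orthogonal to [g], and to
     [w - g] since it is in [H2]. *)
  have [g Hg gP] := orthogonal_projection (H2_closed (R := R)) w2.
  have g2 := H2_L2 Hg.
  have Kg : Ksp alpha g.
    split => // h Hh; have h2 := H2_L2 Hh; have Hah := inner_functionM ia Hh.
    have := gP _ Hah; rewrite innerBl//; last exact: H2_L2.
    rewrite inner_unimodular// (innerC h2 e2).
    by case: Hh => _ ->; rewrite conjc0 sub0r => /eqP; rewrite oppr_eq0 => /eqP.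
  have -> : w = fadd (fsub w g) g by circ_ring.
  rewrite innerDr//; last exact: L2B.
  rewrite (P1 _ Kg) addr0 (innerC (L2B w2 g2) r2).
  by rewrite (gP _ Hr) conjc0.
- move=> h Hh; have h2 := H2_L2 Hh; have bh2 := L2_unimodular ub h2.
  rewrite innerMl fconjK -inner_theta// /r innerBl//; last first.
    exact: L2_unimodular (inner_function_unimodular it) _.
  rewrite (inner_theta f12)//.
  by case: Kf => _ ->//; case: K1 => _ ->; rewrite ?subr0//; exact: inner_functionM.
Qed.

Lemma components_spec f : Ksp theta f -> let p := components alpha beta f in
  [/\ Ksp alpha p.1, Ksp beta p.2 & eqm f (fadd p.1 (fmul alpha p.2))].
Proof.
move=> Kf; have [p0 p0P] := components_exist Kf.
rewrite /components; case: xgetP => [p -> [? [? ?]] //|/(_ p0)].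
by case.
Qed.

Lemma components_unique f1 f2 g1 g2 : Ksp alpha f1 -> Ksp beta f2 ->
  Ksp alpha g1 -> Ksp beta g2 ->
  eqm (fadd f1 (fmul alpha f2)) (fadd g1 (fmul alpha g2)) ->
  eqm f1 g1 /\ eqm f2 g2.
Proof.
move=> K1 K2 L1 M2 e; have F := Ksp_sum K1 K2; have G := Ksp_sum L1 M2.
have F2 := Ksp_L2 F; have G2 := Ksp_L2 G.
have [_ lka _] := Ksp_closed ia; have [_ lkb _] := Ksp_closed ib.
have key h1 h2 : Ksp alpha h1 -> Ksp beta h2 ->
    inner f1 h1 + inner f2 h2 = inner g1 h1 + inner g2 h2.
  move=> N1 N2; rewrite -!inner_sum//.
  by apply: inner_eqm => //; [exact: Ksp_L2 (Ksp_sum N1 N2)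
    |exact: Ksp_L2 (Ksp_sum N1 N2)|exact: eqm_refl].
have f12 := Ksp_L2 K1; have f22 := Ksp_L2 K2.
have g12 := Ksp_L2 L1; have g22 := Ksp_L2 M2.
split.
  apply: (Ksp_eqm_of_inner ia) => // h Kh; have := key h _ Kh lkb.1.
  by rewrite !inner0r// !addr0.
apply: (Ksp_eqm_of_inner ib) => // h Kh; have := key _ h lka.1 Kh.
by rewrite !inner0r// !add0r.
Qed.

Notation Ct := (conjugation theta).
Notation Cab := (conjugation2 alpha beta).

Lemma conjugation2_Ksp f : Ksp theta f -> Ksp theta (Cab f).
Proof.
by move=> /components_spec[K1 K2 _]; apply: Ksp_sum; exact: conjugation_Ksp.
Qed.

Lemma conjugation2E f f1 f2 : Ksp alpha f1 -> Ksp beta f2 -> Ksp theta f ->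
  eqm f (fadd f1 (fmul alpha f2)) ->
  eqm (Cab f) (fadd (conjugation alpha f1) (fmul alpha (conjugation beta f2))).
Proof.
move=> K1 K2 Kf e; have [L1 L2' e'] := components_spec Kf.
have [e1 e2] := components_unique L1 L2' K1 K2 (eqm_trans (eqm_sym e') e).
apply: eqm_fadd; first exact: conjugation_eqm.
by apply: eqm_fmul; exact: conjugation_eqm.
Qed.

(** The common interface of [Ct] and [Cab]. The symmetry clause is the form in which being an
    isometric involution is used: [<C f, g> = <C g, C (C f)> = <C g, f>]. *)
Definition conjugation_like (C : op R) := [/\ antilinear_on (Ksp theta) (Ksp theta) C,
  bounded_on (Ksp theta) C &
  forall f g, Ksp theta f -> Ksp theta g -> inner (C f) g = inner (C g) f].

Lemma Ct_conjugation_like : conjugation_like Ct.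
Proof.
split.
- split; first by move=> f; exact: conjugation_Ksp.
  by move=> c f g _ _; rewrite conjugation_antilinear; exact: eqm_refl.
- apply/bounded_onP; exists 1 => // f Kf.
  by rewrite nsq_conjugation ?mul1r//; exact: Ksp_L2 Kf.
- by move=> f g _ _; exact: conjugation_sym.
Qed.

Lemma Cab_conjugation_like : conjugation_like Cab.
Proof.
have [_ lka _] := Ksp_closed ia; have [_ lkb _] := Ksp_closed ib.
have [_ lkt _] := Ksp_closed it.
split.
- split; first exact: conjugation2_Ksp.
  move=> c f g Kf Kg; have [F1 F2 ef] := components_spec Kf.
  have [G1 G2 eg] := components_spec Kg.
  have Kfg : Ksp theta (fadd (fscale c f) g) by exact: lkt.2.
  have S1 := lka.2 c _ _ F1 G1; have S2 := lkb.2 c _ _ F2 G2.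
  apply: eqm_trans (conjugation2E S1 S2 Kfg _) _.
    apply: eqm_trans (eqm_fadd (eqm_fscale c ef) eg) _.
    suff -> : forall u v u' v', fadd (fscale c (fadd u (fmul alpha v)))
       (fadd u' (fmul alpha v')) = fadd (fadd (fscale c u) u')
       (fmul alpha (fadd (fscale c v) v')) by exact: eqm_refl.
    by move=> *; circ_ring.
  rewrite !conjugation_antilinear /conjugation2.
  set u := conjugation alpha _; set v := conjugation beta _.
  set u' := conjugation alpha _; set v' := conjugation beta _.
  suff -> : fadd (fadd (fscale c^*%C u) u') (fmul alpha (fadd (fscale c^*%C v) v')) =
    fadd (fscale c^*%C (fadd u (fmul alpha v))) (fadd u' (fmul alpha v')).
    exact: eqm_refl.
  by circ_ring.
- apply/bounded_onP; exists 1 => // f Kf; have [F1 F2 ef] := components_spec Kf.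
  rewrite mul1r /conjugation2 nsq_sum; do ?exact: conjugation_Ksp.
  rewrite !nsq_conjugation//; [|exact: Ksp_L2 F2|exact: Ksp_L2 F1].
  by rewrite -nsq_sum// (nsq_eqm (Ksp_L2 Kf) (Ksp_L2 (Ksp_sum F1 F2)) ef).
- have half f g : Ksp theta f -> Ksp theta g -> inner (Cab f) g =
      inner (conjugation alpha (components alpha beta f).1) (components alpha beta g).1 +
      inner (conjugation beta (components alpha beta f).2) (components alpha beta g).2.
    move=> Kf Kg; have [F1 F2 ef] := components_spec Kf.
    have [G1 G2 eg] := components_spec Kg.
    have CK := Ksp_L2 (conjugation2_Ksp Kf).
    rewrite (inner_eqm CK CK (Ksp_L2 Kg) (Ksp_L2 (Ksp_sum G1 G2)) (eqm_refl _) eg).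
    by rewrite inner_sum//; exact: conjugation_Ksp.
  move=> f g Kf Kg; rewrite !half// conjugation_sym; congr (_ + _).
  exact: conjugation_sym.
Qed.

(** Boundedness of [f] alone gives no control of its components, hence none of [Cab f]. Requiring
    bounded components makes both [Ct f] and [Cab f] bounded. *)
Definition bounded_sums := [set f | exists f1 f2, [/\ Kinfty alpha f1, Kinfty beta f2 &
  f = fadd f1 (fmul alpha f2)]].

Lemma bounded_sums_dense : dense_in bounded_sums (Ksp theta).
Proof.
have [_ lka _] := Ksp_closed ia; have [_ lkb _] := Ksp_closed ib.
move=> f e Kf e0; have [F1 F2 ef] := components_spec Kf.
set p := components alpha beta f in F1 F2 ef.
have e20 : 0 < e / 2 by rewrite divr_gt0.
have [d1 D1 h1] := Kinfty_dense ia F1 e20; have [d2 D2 h2] := Kinfty_dense ib F2 e20.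
exists (fadd d1 (fmul alpha d2)); first by exists d1, d2.
have [K1 _] := D1; have [K2 _] := D2.
have S1 := subspaceB lka F1 K1; have S2 := subspaceB lkb F2 K2.
rewrite (@nsq_eqm _ _ (fadd (fsub p.1 d1) (fmul alpha (fsub p.2 d2)))).
- rewrite nsq_sum// [e]splitr; exact: lerD.
- by apply: L2B; [exact: Ksp_L2 Kf|exact: Ksp_L2 (Ksp_sum K1 K2)].
- exact: Ksp_L2 (Ksp_sum S1 S2).
move/eqmP: ef => ef; apply/eqmP; apply: aeS ef => t.
by rewrite /fsub => ->; rewrite /fadd /fmul; ring.
Qed.

Lemma bounded_sums_Kb f : bounded_sums f -> Kinfty theta f.
Proof.
move=> [f1 [f2 [[K1 b1] [K2 b2] ->]]]; split; first exact: Ksp_sum.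
by apply: bounded_aeD => //; apply: bounded_aeM => //; exact: unimodular_bounded.
Qed.

Lemma bounded_sums_Ct f : bounded_sums f -> bounded_ae (Ct f).
Proof. by move=> /bounded_sums_Kb[_ bf]; exact: bounded_conjugation. Qed.

Lemma bounded_sums_Cab f : bounded_sums f -> bounded_ae (Cab f).
Proof.
move=> Bf; have [Kf _] := bounded_sums_Kb Bf.
have [f1 [f2 [[K1 b1] [K2 b2] fE]]] := Bf.
have ef : eqm f (fadd f1 (fmul alpha f2)) by rewrite fE; exact: eqm_refl.
apply: bounded_ae_eqm (eqm_sym (conjugation2E K1 K2 Kf ef)) _.
apply: bounded_aeD; first exact: bounded_conjugation.
by apply: bounded_aeM; [exact: unimodular_bounded|exact: bounded_conjugation].
Qed.

(** * Antilinear selfadjointness from a symmetric form *)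

Section Main.
Variables (phi psi : circ R) (C1 C2 : op R).
Hypotheses (phi2 : L2 phi) (psi2 : L2 psi).
Hypotheses (cl1 : conjugation_like C1) (cl2 : conjugation_like C2).
Hypotheses (bA : att_bounded theta alpha phi) (bB : att_bounded theta beta psi).
Hypotheses (bA' : att_bounded alpha theta (fconj phi))
  (bB' : att_bounded beta theta (fconj psi)).
Hypotheses (bC1 : forall f, bounded_sums f -> bounded_ae (C1 f))
  (bC2 : forall f, bounded_sums f -> bounded_ae (C2 f)).
Hypothesis form_sym : forall f1 f2 g1 g2, Kinfty alpha f1 -> Kinfty beta f2 ->
  Kinfty alpha g1 -> Kinfty beta g2 ->
  let f := fadd f1 (fmul alpha f2) in let g := fadd g1 (fmul alpha g2) in
  inner (fmul phi (C1 f)) g1 + inner (fmul psi (C2 f)) g2 =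
  inner (fmul phi (C1 g)) f1 + inner (fmul psi (C2 g)) f2.

(** All three left-hand sides at once: [C1 = C2 = Ct] with [psi = phi * conj alpha]; [C1 = C2 = Cab]
    with [psi = phi * beta]; and [C1 = Cab], [C2 = Ct] with [psi = phi]. Each case then has to
    supply [form_sym]. *)
Definition symmetrized : op R := fun f =>
  fadd (att theta alpha phi (C1 f)) (fmul alpha (att theta beta psi (C2 f))).
Notation X := symmetrized.

Let KC1 f : Ksp theta f -> Ksp theta (C1 f).
Proof. by case: cl1 => -[H _] _ _; exact: H. Qed.
Let KC2 f : Ksp theta f -> Ksp theta (C2 f).
Proof. by case: cl2 => -[H _] _ _; exact: H. Qed.
Let KA f : Ksp theta f -> Ksp alpha (att theta alpha phi f).
Proof. exact: att_Ksp. Qed.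
Let KB f : Ksp theta f -> Ksp beta (att theta beta psi f).
Proof. exact: att_Ksp. Qed.

Lemma symmetrized_antilinear : antilinear_on (Ksp theta) (Ksp theta) X.
Proof.
have [_ lkt _] := Ksp_closed it.
split; first by move=> f Kf; apply: Ksp_sum; [exact/KA/KC1|exact/KB/KC2].
move=> c f g Kf Kg.
have [[_ l1] _ _] := cl1; have [[_ l2] _ _] := cl2.
have [lA bdA _] := att_spec it ia phi2 bA; have [lB bdB _] := att_spec it ib psi2 bB.
have Kfg : Ksp theta (fadd (fscale c f) g) by exact: lkt.2.
have comb (C D : op R) K : closed_subspace K ->
    (forall f, Ksp theta f -> Ksp theta (C f)) ->
    eqm (C (fadd (fscale c f) g)) (fadd (fscale c^*%C (C f)) (C g)) ->
    linear_on (Ksp theta) K D -> bounded_on (Ksp theta) D ->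
    eqm (D (C (fadd (fscale c f) g))) (fadd (fscale c^*%C (D (C f))) (D (C g))).
  move=> clK KC lC lD bD.
  have := linear_on_eqm (Ksp_closed it) clK lD bD (KC _ Kfg)
    (lkt.2 c^*%C _ _ (KC _ Kf) (KC _ Kg)) lC.
  by move/eqm_trans; apply; apply: lD.2; exact: KC.
have eA := comb C1 _ _ (Ksp_closed ia) KC1 (l1 c f g Kf Kg) lA bdA.
have eB := comb C2 _ _ (Ksp_closed ib) KC2 (l2 c f g Kf Kg) lB bdB.
apply: eqm_trans (eqm_fadd eA (eqm_fmul alpha eB)) _.
rewrite /X; set u := att theta alpha phi (C1 f); set u' := att theta alpha phi (C1 g).
set v := att theta beta psi (C2 f); set v' := att theta beta psi (C2 g).
suff -> : fadd (fadd (fscale c^*%C u) u') (fmul alpha (fadd (fscale c^*%C v) v')) =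
    fadd (fscale c^*%C (fadd u (fmul alpha v))) (fadd u' (fmul alpha v')).
  exact: eqm_refl.
by circ_ring.
Qed.

Lemma symmetrized_bounded : bounded_on (Ksp theta) X.
Proof.
have [_ /bounded_onP[M1 M10 H1] _] := cl1; have [_ /bounded_onP[M2 M20 H2'] _] := cl2.
have [_ /bounded_onP[N1 N10 G1] _] := att_spec it ia phi2 bA.
have [_ /bounded_onP[N2 N20 G2] _] := att_spec it ib psi2 bB.
apply/bounded_onP; exists (N1 * M1 + N2 * M2); first by rewrite addr_ge0 ?mulr_ge0.
move=> f Kf; rewrite /X nsq_sum; [|exact/KA/KC1|exact/KB/KC2].
rewrite mulrDl -!mulrA lerD//.
  by apply: le_trans (G1 _ (KC1 Kf)) _; rewrite ler_wpM2l// H1.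
by apply: le_trans (G2 _ (KC2 Kf)) _; rewrite ler_wpM2l// H2'.
Qed.

Lemma inner_symmetrized_bounded f g1 g2 : bounded_sums f ->
  Ksp alpha g1 -> Ksp beta g2 ->
  inner (X f) (fadd g1 (fmul alpha g2)) =
  inner (fmul phi (C1 f)) g1 + inner (fmul psi (C2 f)) g2.
Proof.
move=> Bf L1 M2; have [Kf _] := bounded_sums_Kb Bf.
have [_ f1] := Kinfty_att_dom phi2 (conj (KC1 Kf) (bC1 Bf)).
have [_ f2] := Kinfty_att_dom psi2 (conj (KC2 Kf) (bC2 Bf)).
rewrite inner_sum//; [|exact/KA/KC1|exact/KB/KC2].
by rewrite (inner_att it ia phi2 bA (KC1 Kf) f1 L1) (inner_att it ib psi2 bB (KC2 Kf) f2 M2).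
Qed.

Lemma symmetrized_sym f g : Ksp theta f -> Ksp theta g ->
  inner (X f) g = inner (X g) f.
Proof.
apply: (symmetric_extension (Ksp_closed it) _ bounded_sums_dense
  symmetrized_antilinear symmetrized_bounded).
  by move=> h /bounded_sums_Kb[].
move=> {}f {}g Bf Bg.
have [f1 [f2 [Kf1 Kf2 fE]]] := Bf; have [g1 [g2 [Kg1 Kg2 gE]]] := Bg.
rewrite {1}gE inner_symmetrized_bounded//; [|by case: Kg1|by case: Kg2].
rewrite [in RHS]fE inner_symmetrized_bounded//; [|by case: Kf1|by case: Kf2].
by have := form_sym Kf1 Kf2 Kg1 Kg2; rewrite /= -fE -gE.
Qed.

(** By symmetry [X] satisfies the specification of its own antilinear adjoint; the operator that
    [sharp] selects has the same inner products and so agrees with [X] a.e. *)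
Lemma sharp_symmetrized : op_eq (Ksp theta) (sharp (Ksp theta) (Ksp theta) X) X.
Proof.
have XP := symmetrized_antilinear.
have mem : antilinear_on (Ksp theta) (Ksp theta) X /\
    forall f g, Ksp theta f -> Ksp theta g -> inner (X f) g = (inner f (X g))^*%C.
  split => // f g Kf Kg; rewrite symmetrized_sym//.
  by apply: innerC; [exact: Ksp_L2 Kf|exact: Ksp_L2 (XP.1 _ Kg)].
rewrite /sharp; case: xgetP => [Y -> [YK YP]|/(_ X) []] //.
move=> g Kg; apply: (Ksp_eqm_of_inner it); [exact: YK.1|exact: XP.1|].
move=> f Kf; rewrite (symmetrized_sym Kg Kf) (YP f g Kf Kg).
by apply: innerC; [exact: Ksp_L2 Kf|exact: Ksp_L2 (YK.1 _ Kg)].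
Qed.

(* [conj alpha * (alpha * p.2)] agrees with [p.2] only almost everywhere. *)
Lemma inner_symmetrized_adjoint f g : Ksp theta f -> Ksp theta g ->
  let p := to_sum alpha beta f in
  [/\ Ksp theta (att alpha theta (fconj phi) p.1),
      Ksp theta (att beta theta (fconj psi) (fmul (fconj alpha) p.2)) &
      inner (C1 g) (att alpha theta (fconj phi) p.1) +
      inner (C2 g) (att beta theta (fconj psi) (fmul (fconj alpha) p.2)) =
      inner (X g) f].
Proof.
move=> Kf Kg /=; have [F1 F2 ef] := components_spec Kf.
set p := components alpha beta f in F1 F2 ef *.
have e2 := unimodularK p.2 ua; set q := fmul (fconj alpha) _ in e2 *.
have q2 : L2 q.
  by apply: L2_unimodular; [exact: unimodularJ|exact: L2_alphaM].
have Kq : Ksp beta q.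
  exact: closed_subspace_eqm (Ksp_closed ib) F2 q2 (eqm_sym e2).
split; first exact: att_Ksp (L2J phi2) bA' _ F1.
  exact: att_Ksp (L2J psi2) bB' _ Kq.
have KX : Ksp theta (X g) by exact: symmetrized_antilinear.1.
rewrite [RHS](inner_eqm (Ksp_L2 KX) (Ksp_L2 KX) (Ksp_L2 Kf)
  (Ksp_L2 (Ksp_sum F1 F2)) (eqm_refl _) ef).
rewrite inner_sum//; [|exact/KA/KC1|exact/KB/KC2].
rewrite -(att_adjoint it ia phi2 bA bA' (KC1 Kg) F1).
rewrite -(att_adjoint it ib psi2 bB bB' (KC2 Kg) Kq).
have KBg := Ksp_L2 (KB (KC2 Kg)).
by rewrite (inner_eqm KBg KBg q2 (Ksp_L2 F2) (eqm_refl _) e2).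
Qed.

(** Tested against [g], the symmetry of [C1] and [C2] moves each conjugation onto its own summand.
    This is the shape of the third identity. *)
Lemma symmetrized_boxplus : op_eq (Ksp theta) X (boxplus C1 C2
  \o oplus (att alpha theta (fconj phi)) (att beta theta (fconj psi) \o mulop (fconj alpha))
  \o to_sum alpha beta).
Proof.
have [_ lkt _] := Ksp_closed it.
move=> f Kf; have [Ku Kv _] := inner_symmetrized_adjoint Kf Kf.
have KX : Ksp theta (X f) by exact: symmetrized_antilinear.1.
apply: (Ksp_eqm_of_inner it) => //.
  by apply: subspaceD => //; [exact: KC1|exact: KC2].
move=> g Kg; rewrite (symmetrized_sym Kf Kg).
have [_ _ <-] := inner_symmetrized_adjoint Kf Kg.
have [_ _ s1] := cl1; have [_ _ s2] := cl2.
rewrite /boxplus /oplus /mulop /=.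
rewrite innerDl; [|exact: Ksp_L2 (KC1 Ku)|exact: Ksp_L2 (KC2 Kv)|exact: Ksp_L2 Kg].
by rewrite -(s1 _ _ Kg Ku) -(s2 _ _ Kg Kv).
Qed.

(** With a single conjugation the two summands are added before it is applied. Moving it onto [g]
    reduces the identity to additivity of the inner product. *)
Lemma symmetrized_intertwine : C1 = C2 -> op_eq (Ksp theta) X (C1
  \o boxplus (att alpha theta (fconj phi)) (att beta theta (fconj psi) \o mulop (fconj alpha))
  \o to_sum alpha beta).
Proof.
move=> C12; have [_ lkt _] := Ksp_closed it.
move=> f Kf; have [Ku Kv _] := inner_symmetrized_adjoint Kf Kf.
have KX : Ksp theta (X f) by exact: symmetrized_antilinear.1.
have Kuv := subspaceD lkt Ku Kv.
apply: (Ksp_eqm_of_inner it) => //; first exact: KC1.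
move=> g Kg; rewrite (symmetrized_sym Kf Kg).
have [_ _ <-] := inner_symmetrized_adjoint Kf Kg.
have [_ _ s1] := cl1; rewrite -C12.
rewrite /boxplus /mulop /= -(s1 _ _ Kg Kuv).
by rewrite innerDr//; [exact: Ksp_L2 Ku|exact: Ksp_L2 Kv|exact: Ksp_L2 (KC1 Kg)].
Qed.

End Main.

(** * Symmetry of the three forms on bounded functions *)

Lemma L2_Munimodular f u : unimodular u -> L2 f -> L2 (fmul f u).
Proof.
move=> uu f2; have -> : fmul f u = fmul u f by circ_ring.
exact: L2_unimodular.
Qed.

Lemma L2M_bounded phi f : L2 phi -> L2 f -> bounded_ae f -> L2 (fmul phi f).
Proof. by move=> phi2 f2 bf; apply: bounded_ae_L2 => //; exact: L2_cmeas. Qed.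

Lemma L2M_conjugation phi u f : inner_function u -> L2 phi -> L2 f -> bounded_ae f ->
  L2 (fmul phi (conjugation u f)).
Proof.
move=> iu phi2 f2 bf; apply: L2M_bounded => //; last exact: bounded_conjugation.
apply: L2_unimodular; first exact: inner_function_unimodular.
apply: L2_unimodular; last exact: L2J.
exact: unimodularJ (@unimodular_zvar R).
Qed.

Lemma L2M_alpha_conjugation phi f : L2 phi -> L2 f -> bounded_ae f ->
  L2 (fmul phi (fmul alpha (conjugation beta f))).
Proof.
move=> phi2 f2 bf.
have -> : fmul phi (fmul alpha (conjugation beta f)) =
  fmul alpha (fmul phi (conjugation beta f)) by circ_ring.
by apply: L2_unimodular => //; exact: L2M_conjugation.
Qed.

(** [Cab] works on chosen components, which agree with [f1] and [f2] only a.e.; inside an inner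
    product they can be replaced by the given ones. *)
Lemma inner_Cab phi f1 f2 h : L2 phi -> Kinfty alpha f1 -> Kinfty beta f2 -> L2 h ->
  inner (fmul phi (Cab (fadd f1 (fmul alpha f2)))) h =
  inner (fmul phi (conjugation alpha f1)) h +
  inner (fmul phi (fmul alpha (conjugation beta f2))) h.
Proof.
move=> phi2 [K1 b1] [K2 b2] h2; set f := fadd f1 _.
have Bf : bounded_sums f by exists f1, f2.
have [Kf _] := bounded_sums_Kb Bf.
have l1 := L2M_conjugation ia phi2 (Ksp_L2 K1) b1.
have l2 := L2M_alpha_conjugation phi2 (Ksp_L2 K2) b2.
rewrite -innerDl//; apply: inner_eqm => //; last exact: eqm_refl.
- by apply: L2M_bounded => //; [exact: Ksp_L2 (conjugation2_Ksp Kf)|exact: bounded_sums_Cab].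
- exact: L2D.
have := eqm_fmul phi (conjugation2E K1 K2 Kf (eqm_refl _)).
suff -> : fmul phi (fadd (conjugation alpha f1) (fmul alpha (conjugation beta f2))) =
  fadd (fmul phi (conjugation alpha f1)) (fmul phi (fmul alpha (conjugation beta f2))) by [].
by circ_ring.
Qed.

(** The factor [conj alpha] of the second symbol moves to [g2] as [alpha], which reassembles [g] and
    leaves the single term [<phi * Ct f, g>]. *)
Lemma form_sym_Ct phi f1 f2 g1 g2 : L2 phi ->
  Kinfty alpha f1 -> Kinfty beta f2 -> Kinfty alpha g1 -> Kinfty beta g2 ->
  let f := fadd f1 (fmul alpha f2) in let g := fadd g1 (fmul alpha g2) in
  inner (fmul phi (Ct f)) g1 + inner (fmul (fmul phi (fconj alpha)) (Ct f)) g2 =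
  inner (fmul phi (Ct g)) f1 + inner (fmul (fmul phi (fconj alpha)) (Ct g)) f2.
Proof.
move=> phi2 B1 B2 E1 E2 f g.
have one h1 h2 k : Kinfty alpha h1 -> Kinfty beta h2 -> bounded_sums k ->
    inner (fmul phi (Ct k)) h1 + inner (fmul (fmul phi (fconj alpha)) (Ct k)) h2 =
    inner (fmul phi (Ct k)) (fadd h1 (fmul alpha h2)).
  move=> [L1 _] [M2 _] Bk; have [Kk bk] := bounded_sums_Kb Bk.
  have l := L2M_conjugation it phi2 (Ksp_L2 Kk) bk.
  rewrite innerDr//; [|exact: Ksp_L2 L1|exact: L2_alphaM].
  by congr (_ + _); rewrite innerMr /inner; congr cintegral; circ_ring.
rewrite !one//; [|by exists g1, g2|by exists f1, f2].
by rewrite /inner; congr cintegral; rewrite /conjugation; circ_ring.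
Qed.

(** Of the four terms the two diagonal ones are symmetric. The mixed ones exchange: the [beta] of
    the second symbol matches that of [conjugation beta], and both integrands are
    [phi * alpha * beta] times the conjugate of [z * f2 * g1], or of [z * f1 * g2]. *)
Lemma form_sym_Cab phi f1 f2 g1 g2 : L2 phi ->
  Kinfty alpha f1 -> Kinfty beta f2 -> Kinfty alpha g1 -> Kinfty beta g2 ->
  let f := fadd f1 (fmul alpha f2) in let g := fadd g1 (fmul alpha g2) in
  inner (fmul phi (Cab f)) g1 + inner (fmul (fmul phi beta) (Cab f)) g2 =
  inner (fmul phi (Cab g)) f1 + inner (fmul (fmul phi beta) (Cab g)) f2.
Proof.
move=> phi2 B1 B2 E1 E2 f g.
have psi2 := L2_Munimodular (inner_function_unimodular ib) phi2.
have [K1 _] := B1; have [K2 _] := B2; have [L1 _] := E1; have [M2 _] := E2.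
have k1 := Ksp_L2 K1; have k2 := Ksp_L2 K2; have l1 := Ksp_L2 L1; have l2 := Ksp_L2 M2.
rewrite /f /g !inner_Cab//.
have -> : inner (fmul phi (conjugation alpha f1)) g1 = inner (fmul phi (conjugation alpha g1)) f1.
  by rewrite /inner; congr cintegral; rewrite /conjugation; circ_ring.
have -> : inner (fmul phi (fmul alpha (conjugation beta f2))) g1 =
    inner (fmul (fmul phi beta) (conjugation alpha g1)) f2.
  by rewrite /inner; congr cintegral; rewrite /conjugation; circ_ring.
have -> : inner (fmul (fmul phi beta) (conjugation alpha f1)) g2 =
    inner (fmul phi (fmul alpha (conjugation beta g2))) f1.
  by rewrite /inner; congr cintegral; rewrite /conjugation; circ_ring.
have -> : inner (fmul (fmul phi beta) (fmul alpha (conjugation beta f2))) g2 =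
    inner (fmul (fmul phi beta) (fmul alpha (conjugation beta g2))) f2.
  by rewrite /inner; congr cintegral; rewrite /conjugation; circ_ring.
by ring.
Qed.

Lemma form_sym_Cab_Ct phi f1 f2 g1 g2 : L2 phi ->
  Kinfty alpha f1 -> Kinfty beta f2 -> Kinfty alpha g1 -> Kinfty beta g2 ->
  let f := fadd f1 (fmul alpha f2) in let g := fadd g1 (fmul alpha g2) in
  inner (fmul phi (Cab f)) g1 + inner (fmul phi (Ct f)) g2 =
  inner (fmul phi (Cab g)) f1 + inner (fmul phi (Ct g)) f2.
Proof.
move=> phi2 B1 B2 E1 E2 f g.
have CtE h1 h2 k : Kinfty alpha h1 -> Kinfty beta h2 -> Ksp beta k ->
    inner (fmul phi (Ct (fadd h1 (fmul alpha h2)))) k =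
    inner (fmul phi (Ct h1)) k + inner (fmul phi (Ct (fmul alpha h2))) k.
  move=> [L1 b1] [M2 b2] Kk.
  rewrite -innerDl; [|exact: L2M_conjugation (Ksp_L2 L1) b1| |exact: Ksp_L2 Kk].
    by rewrite /inner; congr cintegral; rewrite /conjugation; circ_ring.
  apply: L2M_conjugation => //; first exact: L2_alphaM.
  by apply: bounded_aeM => //; exact: unimodular_bounded.
(* The mixed terms agree because [theta = alpha * beta] almost everywhere. *)
have cross h1 h2 : Kinfty alpha h1 -> Kinfty beta h2 ->
    inner (fmul phi (fmul alpha (conjugation beta h2))) h1 = inner (fmul phi (Ct h1)) h2.
  move=> [L1 b1] [M2 b2].
  have -> : inner (fmul phi (fmul alpha (conjugation beta h2))) h1 =
      inner (fmul phi (fmul alpha (conjugation beta h1))) h2.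
    by rewrite /inner; congr cintegral; rewrite /conjugation; circ_ring.
  apply: inner_eqm; do ?[exact: Ksp_L2 M2 | exact: eqm_refl].
  - exact: L2M_alpha_conjugation (Ksp_L2 L1) b1.
  - exact: L2M_conjugation (Ksp_L2 L1) b1.
  have /eqmP e := inner_divides_eqm; apply/eqmP; apply: aeS e => t.
  by rewrite /conjugation /fmul => ->; rewrite -!mulrA.
have [K1 _] := B1; have [K2 _] := B2; have [L1 _] := E1; have [M2 _] := E2.
have k1 := Ksp_L2 K1; have l1 := Ksp_L2 L1.
rewrite /f /g !inner_Cab//.
rewrite !CtE// !cross//.
have -> : inner (fmul phi (conjugation alpha f1)) g1 = inner (fmul phi (conjugation alpha g1)) f1.
  by rewrite /inner; congr cintegral; rewrite /conjugation; circ_ring.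
have -> : inner (fmul phi (Ct (fmul alpha f2))) g2 = inner (fmul phi (Ct (fmul alpha g2))) f2.
  by rewrite /inner; congr cintegral; rewrite /conjugation; circ_ring.
by ring.
Qed.

End Decomposition.

Theorem theorem5p3 (R : realType) (alpha theta phi : circ R)
    (halpha : inner_function alpha) (htheta : inner_function theta)
    (nalpha : nonconstant alpha) (ntheta : nonconstant theta)
    (hdiv : inner_divides alpha theta) (hphi : L2 phi) :
  let beta := fdiv theta alpha in
  (* boundedness of all the operators that occur *)
  att_bounded theta alpha phi ->
  att_bounded theta beta (fmul phi (fconj alpha)) ->
  att_bounded theta beta (fmul phi beta) ->
  att_bounded theta beta phi ->
  att_bounded alpha theta (fconj phi) ->
  att_bounded beta theta (fmul (fconj phi) alpha) ->
  att_bounded beta theta (fconj (fmul phi beta)) ->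
  att_bounded beta theta (fconj phi) ->
  let Ct := conjugation theta in
  let Cab := conjugation2 alpha beta in
  let lhs1 : op R :=
    of_sum \o diamond (att theta alpha phi)
               (mulop alpha \o att theta beta (fmul phi (fconj alpha))) \o Ct in
  let rhs1 : op R :=
    Ct \o boxplus (att alpha theta (fconj phi))
            (att beta theta (fmul (fconj phi) alpha) \o mulop (fconj alpha))
       \o to_sum alpha beta in
  let lhs2 : op R :=
    of_sum \o diamond (att theta alpha phi)
               (mulop alpha \o att theta beta (fmul phi beta)) \o Cab in
  let rhs2 : op R :=
    Cab \o boxplus (att alpha theta (fconj phi))
             (att beta theta (fconj (fmul phi beta)) \o mulop (fconj alpha))
        \o to_sum alpha beta in
  let lhs3 : op R :=
    of_sum \o oplus (att theta alpha phi) (mulop alpha \o att theta beta phi)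
          \o diamond Cab Ct in
  let rhs3 : op R :=
    boxplus Cab Ct
      \o oplus (att alpha theta (fconj phi))
           (att beta theta (fconj phi) \o mulop (fconj alpha))
      \o to_sum alpha beta in
  [/\ op_eq (Ksp theta) lhs1 rhs1,
      op_eq (Ksp theta) lhs2 rhs2 &
      op_eq (Ksp theta) lhs3 rhs3] /\
  [/\ op_eq (Ksp theta) (sharp (Ksp theta) (Ksp theta) lhs1) lhs1,
      op_eq (Ksp theta) (sharp (Ksp theta) (Ksp theta) lhs2) lhs2 &
      op_eq (Ksp theta) (sharp (Ksp theta) (Ksp theta) lhs3) lhs3].
Proof.
move=> beta b1 b2 b3 b4 b5 b6 b7 b8 Ct Cab lhs1 rhs1 lhs2 rhs2 lhs3 rhs3.
have ib : inner_function beta := hdiv.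
have ua := inner_function_unimodular halpha.
have clt := Ct_conjugation_like htheta.
have clab := Cab_conjugation_like halpha htheta hdiv.
have bt := bounded_sums_Ct halpha htheta hdiv.
have bab := bounded_sums_Cab halpha htheta hdiv.
have psi1 := L2_Munimodular (unimodularJ ua) hphi.
have psi2 := L2_Munimodular (inner_function_unimodular ib) hphi.
(* The statement writes this symbol as a product, while the general result expects the conjugate of
   the symbol on the left-hand side. *)
have psi1J : fmul (fconj phi) alpha = fconj (fmul phi (fconj alpha)) by circ_ring.
have s1 f1 f2 g1 g2 := @form_sym_Ct _ _ _ halpha htheta hdiv phi f1 f2 g1 g2 hphi.
have s2 f1 f2 g1 g2 := @form_sym_Cab _ _ _ halpha htheta hdiv phi f1 f2 g1 g2 hphi.
have s3 f1 f2 g1 g2 := @form_sym_Cab_Ct _ _ _ halpha htheta hdiv phi f1 f2 g1 g2 hphi.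
rewrite psi1J in b6 rhs1 *.
split; split.
- exact: (symmetrized_intertwine halpha htheta hdiv hphi psi1 clt clt b1 b2 b5 b6 bt bt s1).
- exact: (symmetrized_intertwine halpha htheta hdiv hphi psi2 clab clab b1 b3 b5 b7 bab bab s2).
- exact: (symmetrized_boxplus halpha htheta hdiv hphi hphi clab clt b1 b4 b5 b8 bab bt s3).
- exact: (sharp_symmetrized halpha htheta hdiv hphi psi1 clt clt b1 b2 bt bt s1).
- exact: (sharp_symmetrized halpha htheta hdiv hphi psi2 clab clab b1 b3 bab bab s2).
- exact: (sharp_symmetrized halpha htheta hdiv hphi hphi clab clt b1 b4 bab bt s3).
Qed.
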